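(* Let $(R,\mathfrak m)$ be a complete noetherian local integral domain with fraction field $Q$. The following assertions are equivalent: (i) Any torsion-free $R$-module of finite rank is of the form $Q^t\oplus M$, where $M$ is a finitely generated $R$-module. (ii) $\dim R\le 1$. (iii) Any torsion-free $R$-module of finite rank is Matlis reflexive. (iv) Suppose $S$ is a torsion-free $R$-module of finite rank. Then $\mathfrak m S=S$ if and only if $S$ is injective.
   Context: The rank of a torsion-free $R$-module $S$ is $\dim_Q(Q\otimes_R S)$. ''Complete'' means complete in the $\mathfrak m$-adic topology. Let $k=R/\mathfrak m$, let $E_R(k)$ be the injective envelope of $k$, and $(-)^\vee=\operatorname{Hom}_R(-,E_R(k))$. A module $S$ is Matlis reflexive if the natural evaluation map $S\to S^{\vee\vee}$ is an isomorphism.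
   Formalization: The equivalence of (iv) with the other assertions is stated only when R is not a field; for a field, m = 0 and S = R is injective with mS ≠ S, so (iv) fails although (i)–(iii) hold. The equivalence of (i)–(iii) is stated for every R. *)

(* Defs.v *)
From HB Require Import structures.
From mathcomp Require Import all_boot all_order all_algebra.
From mathcomp Require Import generic_quotient ring_quotient fraction.
From mathcomp Require Import boolp classical_sets functions.

Set Implicit Arguments.
Unset Strict Implicit.
Unset Printing Implicit Defensive.
Import GRing.Theory.
Local Open Scope ring_scope.
Local Open Scope quotient_scope.

(* [idealr R] consists of the proper ideals of R. *)

Definition noetherian (R : comNzRingType) :=
  forall I : idealr R, exists n (g : 'I_n -> R),
    forall x, x \in I <-> exists a : 'I_n -> R, x = \sum_i a i * g i.

Definition maximal_ideal (R : comNzRingType) (m : idealr R) :=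
  forall I : idealr R, {subset m <= I} -> {subset I <= m}.

Definition local_with (R : comNzRingType) (m : idealr R) :=
  maximal_ideal m /\ forall I : idealr R, maximal_ideal I -> I =i m.

Definition prime_chain (R : comNzRingType) n (p : nat -> prime_idealr R) :=
  forall i, (i < n)%N ->
    {subset p i <= p i.+1} /\ ~ {subset p i.+1 <= p i}.

Definition krull_dim_le (R : comNzRingType) d :=
  forall n (p : nat -> prime_idealr R), prime_chain n p -> (n <= d)%N.

(* The submodule I N of V, for an ideal I and a submodule N of V. *)
Definition ideal_smul (R : comNzRingType) (V : lmodType R)
    (I : {pred R}) (N : set V) : set V :=
  [set v | exists n (a : 'I_n -> R) (w : 'I_n -> V),
     (forall i, a i \in I /\ N (w i)) /\ v = \sum_i a i *: w i]%classic.

Definition ideal_exp (R : comNzRingType) (I : {pred R}) n : set R^o :=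
  iter n (@ideal_smul R R^o I) setT.

(* Cauchy sequences suffice, as the I-adic topology has the countable base    *)
(* (I^n)_n at 0; uniqueness of limits says that this topology is separated.   *)
Definition adically_complete (R : comNzRingType) (I : {pred R}) :=
  forall u : nat -> R,
    (forall n, exists N, forall i j, (N <= i)%N -> (N <= j)%N ->
       ideal_exp I n (u i - u j)) ->
    exists! l : R, forall n, exists N, forall i, (N <= i)%N ->
       ideal_exp I n (u i - l).

Section ResidueModule.
Variables (R : comNzRingType) (I : idealr R).

Let scale (a : R) (x : {ideal_quot I}) : {ideal_quot I} := \pi a * x.

Fact ideal_quot_scalerA a b x : scale a (scale b x) = scale (a * b) x.
Proof. by rewrite /scale rmorphM mulrA. Qed.
Fact ideal_quot_scale1r : left_id 1 scale.
Proof. by move=> x; rewrite /scale rmorph1 mul1r. Qed.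
Fact ideal_quot_scalerDr : right_distributive scale +%R.
Proof. by move=> a x y; rewrite /scale mulrDr. Qed.
Fact ideal_quot_scalerDl x : {morph scale^~ x : a b / a + b}.
Proof. by move=> a b; rewrite /scale rmorphD mulrDl. Qed.

HB.instance Definition _ := GRing.Zmodule_isLmodule.Build R {ideal_quot I}
  ideal_quot_scalerA ideal_quot_scale1r ideal_quot_scalerDr
  ideal_quot_scalerDl.
End ResidueModule.

Section FractionModule.
Variable R : idomainType.

Let scale (a : R) (x : {fraction R}) : {fraction R} := tofrac a * x.

Fact fraction_scalerA a b x : scale a (scale b x) = scale (a * b) x.
Proof. by rewrite /scale rmorphM mulrA. Qed.
Fact fraction_scale1r : left_id 1 scale.
Proof. by move=> x; rewrite /scale rmorph1 mul1r. Qed.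
Fact fraction_scalerDr : right_distributive scale +%R.
Proof. by move=> a x y; rewrite /scale mulrDr. Qed.
Fact fraction_scalerDl x : {morph scale^~ x : a b / a + b}.
Proof. by move=> a b; rewrite /scale rmorphD mulrDl. Qed.

HB.instance Definition _ := GRing.Zmodule_isLmodule.Build R {fraction R}
  fraction_scalerA fraction_scale1r fraction_scalerDr fraction_scalerDl.
End FractionModule.

(* Q (x)_R S, for Q the fraction field of R: a list of pairs (q, s) stands    *)
(* for the sum of the q (x) s, and two lists are identified when the defining *)
(* relations of the tensor product equate them.                               *)
Section FracTensor.
Variables (R : idomainType) (S : lmodType R).
Local Notation Q := {fraction R}.
Implicit Types (l : seq (Q * S)) (q : Q) (s : S).

Inductive tensor_rel : seq (Q * S) -> seq (Q * S) -> Prop :=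
| TensorRefl l : tensor_rel l l
| TensorSym l1 l2 : tensor_rel l1 l2 -> tensor_rel l2 l1
| TensorTrans l1 l2 l3 :
    tensor_rel l1 l2 -> tensor_rel l2 l3 -> tensor_rel l1 l3
| TensorCat l1 l2 l1' l2' : tensor_rel l1 l1' -> tensor_rel l2 l2' ->
    tensor_rel (l1 ++ l2) (l1' ++ l2')
| TensorCatC l1 l2 : tensor_rel (l1 ++ l2) (l2 ++ l1)
| TensorZero s : tensor_rel [:: (0, s)] [::]
| TensorAddl q1 q2 s :
    tensor_rel [:: (q1 + q2, s)] [:: (q1, s); (q2, s)]
| TensorAddr q s1 s2 :
    tensor_rel [:: (q, s1 + s2)] [:: (q, s1); (q, s2)]
| TensorBalanced (a : R) q s : tensor_rel [:: (a *: q, s)] [:: (q, a *: s)].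

Definition tensor_relb : rel (seq (Q * S)) :=
  fun l1 l2 => `[< tensor_rel l1 l2 >].

Fact tensor_relb_refl : reflexive tensor_relb.
Proof. by move=> l; apply/asboolP/TensorRefl. Qed.
Fact tensor_relb_sym : symmetric tensor_relb.
Proof. by move=> l1 l2; apply/asboolP/asboolP; apply: TensorSym. Qed.
Fact tensor_relb_trans : transitive tensor_relb.
Proof.
by move=> l2 l1 l3 /asboolP l12 /asboolP l23; apply/asboolP/(TensorTrans l12).
Qed.

Canonical tensor_equiv :=
  EquivRel tensor_relb tensor_relb_refl tensor_relb_sym tensor_relb_trans.

Definition frac_tensor := {eq_quot tensor_relb}.
HB.instance Definition _ : EqQuotient _ tensor_relb frac_tensor :=
  EqQuotient.on frac_tensor.
HB.instance Definition _ := Choice.on frac_tensor.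

Fact pi_tensorP l1 l2 :
  tensor_rel l1 l2 <-> \pi_frac_tensor l1 = \pi_frac_tensor l2.
Proof. by split=> [l12|/eqmodP/asboolP//]; apply/eqmodP/asboolP. Qed.

Definition scale_pairs q l := [seq (q * p.1, p.2) | p <- l].

Fact tensor_rel_scale q l1 l2 :
  tensor_rel l1 l2 -> tensor_rel (scale_pairs q l1) (scale_pairs q l2).
Proof.
elim=> {l1 l2} [l|l1 l2 _|l1 l2 l3 _ h1 _ h2|l1 l2 l1' l2' _ h1 _ h2|l1 l2
  |s|q1 q2 s|q1 s1 s2|a q1 s].
- exact: TensorRefl.
- exact: TensorSym.
- exact: TensorTrans h1 h2.
- by rewrite /scale_pairs !map_cat; exact: TensorCat.
- by rewrite /scale_pairs !map_cat; exact: TensorCatC.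
- by rewrite /= mulr0; exact: TensorZero.
- by rewrite /= mulrDr; exact: TensorAddl.
- exact: TensorAddr.
- have /= -> : q * (a *: q1) = a *: (q * q1) by rewrite mulrCA.
  exact: TensorBalanced.
Qed.

Definition tensor_add := lift_op2 frac_tensor cat.
Definition tensor_scale q := lift_op1 frac_tensor (scale_pairs q).

Fact pi_tensor_add l1 l2 :
  tensor_add (\pi l1) (\pi l2) = \pi_frac_tensor (l1 ++ l2).
Proof.
unlock tensor_add; apply/pi_tensorP/TensorCat; apply/pi_tensorP.
  by rewrite reprK.
by rewrite reprK.
Qed.

Fact pi_tensor_scale q l :
  tensor_scale q (\pi l) = \pi_frac_tensor (scale_pairs q l).
Proof.
rewrite /tensor_scale; unlock; apply/pi_tensorP/tensor_rel_scale/pi_tensorP.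
by rewrite reprK.
Qed.

Fact pi_tensor_surj x : exists l, x = \pi_frac_tensor l.
Proof. by exists (repr x); rewrite reprK. Qed.

Fact tensor_addA : associative tensor_add.
Proof.
move=> x y z; have [l ->] := pi_tensor_surj x; have [l' ->] := pi_tensor_surj y.
have [l'' ->] := pi_tensor_surj z; by rewrite !pi_tensor_add catA.
Qed.
Fact tensor_addC : commutative tensor_add.
Proof.
move=> x y; have [l ->] := pi_tensor_surj x; have [l' ->] := pi_tensor_surj y.
by rewrite !pi_tensor_add; apply/pi_tensorP/TensorCatC.
Qed.
Fact tensor_add0 : left_id (\pi_frac_tensor [::]) tensor_add.
Proof. by move=> x; have [l ->] := pi_tensor_surj x; rewrite pi_tensor_add. Qed.

Fact tensor_scaleDl x : {morph tensor_scale^~ x : q1 q2 / q1 + q2 >->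
  tensor_add q1 q2}.
Proof.
have [l ->] := pi_tensor_surj x => q1 q2; rewrite !pi_tensor_scale pi_tensor_add.
apply/pi_tensorP; elim: l => [|[q s] l ihl] /=; first exact: TensorRefl.
rewrite mulrDl -cat1s -[X in tensor_rel _ X]cat1s.
apply: TensorTrans (TensorCat (TensorAddl _ _ _) ihl) _.
set A := scale_pairs q1 l; set B := scale_pairs q2 l.
have h := TensorCat (TensorCatC [:: (q2 * q, s)] A) (TensorRefl B).
by move: (TensorCat (TensorRefl [:: (q1 * q, s)]) h); rewrite -!catA.
Qed.
Fact tensor_scale0 x : tensor_scale 0 x = \pi_frac_tensor [::].
Proof.
have [l ->] := pi_tensor_surj x; rewrite pi_tensor_scale; apply/pi_tensorP.
elim: l => [|[q s] l ihl] /=; first exact: TensorRefl.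
by rewrite mul0r; exact: (TensorCat (TensorZero s) ihl).
Qed.
Fact tensor_scale1 : left_id 1 tensor_scale.
Proof.
move=> x; have [l ->] := pi_tensor_surj x; rewrite pi_tensor_scale; congr (\pi _).
by rewrite -[RHS]map_id; apply: eq_map => -[q s]; rewrite mul1r.
Qed.
Fact tensor_addN :
  left_inverse (\pi_frac_tensor [::]) (tensor_scale (-1)) tensor_add.
Proof.
by move=> x; rewrite -{2}[x]tensor_scale1 -tensor_scaleDl addNr tensor_scale0.
Qed.

HB.instance Definition _ := GRing.isZmodule.Build frac_tensor
  tensor_addA tensor_addC tensor_add0 tensor_addN.

Fact tensor_scaleA q1 q2 x :
  tensor_scale q1 (tensor_scale q2 x) = tensor_scale (q1 * q2) x.
Proof.
have [l ->] := pi_tensor_surj x; rewrite !pi_tensor_scale; congr (\pi _).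
by rewrite /scale_pairs -map_comp; apply: eq_map => p /=; rewrite mulrA.
Qed.
Fact pi_tensorD l1 l2 :
  \pi_frac_tensor (l1 ++ l2) = \pi_frac_tensor l1 + \pi_frac_tensor l2.
Proof. by rewrite -pi_tensor_add. Qed.
Fact tensor_scaleDr : right_distributive tensor_scale +%R.
Proof.
move=> q x y; have [l ->] := pi_tensor_surj x; have [l' ->] := pi_tensor_surj y.
by rewrite -pi_tensorD !pi_tensor_scale -pi_tensorD /scale_pairs map_cat.
Qed.

HB.instance Definition _ := GRing.Zmodule_isLmodule.Build Q frac_tensor
  tensor_scaleA tensor_scale1 tensor_scaleDr tensor_scaleDl.
End FracTensor.

Definition has_dim (F : fieldType) (V : lmodType F) n :=
  exists b : 'I_n -> V, forall v,
    exists! c : {ffun 'I_n -> F}, v = \sum_i c i *: b i.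

Definition has_rank (R : idomainType) (S : lmodType R) n :=
  has_dim (frac_tensor S) n.

Definition finite_rank (R : idomainType) (S : lmodType R) :=
  exists n, has_rank S n.

Definition torsion_free (R : idomainType) (S : lmodType R) :=
  forall (a : R) (s : S), a *: s = 0 -> a = 0 \/ s = 0.

Definition fin_gen (R : comNzRingType) (M : lmodType R) :=
  exists n (g : 'I_n -> M), forall x, exists a : 'I_n -> R,
    x = \sum_i a i *: g i.

Definition lmod_iso (R : comNzRingType) (U V : lmodType R) :=
  exists f : {linear U -> V}, bijective f.

Definition injective_module (R : comNzRingType) (E : lmodType R) :=
  forall (A B : lmodType R) (i : {linear A -> B}) (f : {linear A -> E}),
    injective i -> exists g : {linear B -> E}, forall a, g (i a) = f a.

(* [i] is an essential monomorphism into an injective module. *)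
Definition is_injective_envelope (R : comNzRingType) (V E : lmodType R)
    (i : {linear V -> E}) :=
  [/\ injective_module E, injective i &
      forall N : {pred E}, submod_closed N ->
        (forall v, i v \in N -> v = 0) -> forall e, e \in N -> e = 0].

(* Hom_R(U, V) with its pointwise R-module structure. *)
Section Hom.
Variables (R : comNzRingType) (U V : lmodType R).

Definition is_linear : {pred U -> V} := fun f => `[< linear f >].

Record hom := Hom { hom_fun :> U -> V; _ : hom_fun \in is_linear }.

HB.instance Definition _ := [isSub for hom_fun].
HB.instance Definition _ := [Choice of hom by <:].

Fact is_linear_submod_closed : submod_closed is_linear.
Proof.
split=> [|a f g /asboolP lf /asboolP lg]; apply/asboolP => b x y.
  by rewrite /= scaler0 addr0.
have E h z : (a *: h + g) z = a *: h z + g z by [].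
by rewrite !E lf lg !scalerDr !scalerA [a * b]mulrC addrACA.
Qed.

HB.instance Definition _ :=
  GRing.isSubmodClosed.Build R (U -> V) is_linear is_linear_submod_closed.
HB.instance Definition _ := [SubChoice_isSubLmodule of hom by <:].

Fact hom_linear (f : hom) : linear f.
Proof. by case: f => f /= /asboolP. Qed.
End Hom.

Section Evaluation.
Variables (R : comNzRingType) (E S : lmodType R).
Local Notation "M ^v" := (hom M E) (at level 2, format "M ^v").

Fact evaluation_subproof (s : S) :
  (fun f : S^v => f s) \in @is_linear R S^v E.
Proof. by apply/asboolP => a f g. Qed.

Definition evaluation (s : S) : (S^v : lmodType R)^v :=
  Hom (evaluation_subproof s).

Definition matlis_reflexive := bijective evaluation.
End Evaluation.

(* Main.v *)
(* Over a complete local domain of dimension at most one, fix x <> 0 in m.    *)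
(* Every R/N with N <> 0 has finite length, and comparing lengths gives       *)
(* l(S/xS) <= n l(R/xR) for S torsion-free of rank n.  Hence S = M + xS with  *)
(* M finitely generated, and completeness improves this to S = M + D, with D  *)
(* the intersection of the x^k S.  As D is divisible it is a Q-subspace of    *)
(* Q (x) S, and restricting a projection of Q (x) S onto D splits it off S.   *)
(*   Reflexivity is then needed only for R and Q.  Descending along           *)
(* 0 -> R/(N:a) -> R/N -> R/(N+aR), every endomorphism of E is a scalar on    *)
(* the elements killed by N, so that End(E) = R in the limit.  Consequently a *)
(* nonzero map Q -> E is onto; its kernel is finitely generated, hence        *)
(* complete, and any f : Q -> E lifts through it.  Thus Hom(Q, E) is          *)
(* one-dimensional over Q, and Q is reflexive.                                *)
(*   Conversely let P be a prime with 0 <> P <> m.  Then m R_P = R_P, while   *)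
(* R_P is neither injective nor of the form Q^t + M, which refutes (i) and    *)
(* (iv).  Krull's principal ideal theorem yields two distinct primes P1, P2   *)
(* of height one, and R_P1 + q R_P2 = Q for every q <> 0, so that nonzero     *)
(* maps f, g : Q -> E killing R_P1 and R_P2 are Q-linearly independent.       *)
(* Therefore Hom(Hom(Q, E), E) is larger than Q, which refutes (iii).         *)

(* The dimension enters through one fact: in dimension at most one, a nonzero prime is [m]
   ([dim_le1P]). By [prime_ind], claims about all nonzero ideals then reduce to [m]: finite length
   ([finite_len]), containing a power of [m] ([max_power_sub]), scalar action of endomorphisms of E
   ([endo_scalar_ideal]), divisibility of S when m S = S ([max_divisible]). The bound
   [len_torsion_quotient] and completeness give [reduced_fg], whence the splitting
   [torsion_free_decomposition], which is (i). For (iii), surjectivity of evaluation passes to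
   finite sums and quotients, so that [eval_surj_ring] and [eval_surj_frac] suffice. For (iv),
   injective modules are divisible, and [divisible_injective] is the converse for torsion-free ones.
   In larger dimension R_P violates (i) and (iv) ([loc_not_decomposable], [loc_not_injective]), and
   Q violates (iii) ([frac_not_reflexive], resting on [krull_height_one] and [loc_sum]). *)
Require Import Defs.
From HB Require Import structures.
From mathcomp Require Import all_boot all_order all_algebra.
From mathcomp Require Import generic_quotient ring_quotient fraction.
From mathcomp Require Import boolp classical_sets functions.
From mathcomp Require Import ring.
(* Again, since vector.v also defines [hom]. *)
Require Import Defs.

Set Implicit Arguments.
Unset Strict Implicit.
Unset Printing Implicit Defensive.
Import GRing.Theory.
Local Open Scope ring_scope.
Local Open Scope classical_set_scope.
Local Open Scope quotient_scope.

(** * Submodules and ideals *)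

Section Submodules.
Variables (R : comNzRingType) (V : lmodType R).
Implicit Types (A B C : set V) (u v s : V) (a r : R).

(** Submodules are plain sets; ideals are those of [R^o], so that the unit ideal is included, unlike
    in [idealr]. *)
Definition submod A := A 0 /\ forall a u v, A u -> A v -> A (a *: u + v).

Lemma submod0 A : submod A -> A 0. Proof. by case. Qed.

Lemma submodD A u v : submod A -> A u -> A v -> A (u + v).
Proof. by case=> _ hA Au Av; have := hA 1 u v Au Av; rewrite scale1r. Qed.

Lemma submodZ A a u : submod A -> A u -> A (a *: u).
Proof. by move=> [A0 hA] Au; rewrite -[_ *: _]addr0; apply: hA. Qed.

Lemma submodN A u : submod A -> A u -> A (- u).
Proof. by move=> sA Au; rewrite -scaleN1r; apply: submodZ. Qed.

Lemma submodB A u v : submod A -> A u -> A v -> A (u - v).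
Proof. by move=> sA Au Av; apply: submodD => //; apply: submodN. Qed.

Lemma submod_sum A (I : Type) (r : seq I) (P : pred I) (F : I -> V) :
  submod A -> (forall i, P i -> A (F i)) -> A (\sum_(i <- r | P i) F i).
Proof.
by move=> sA AF; elim/big_ind: _ => //; [exact: submod0 | move=> *; exact: submodD].
Qed.

Lemma submodT : submod setT. Proof. by []. Qed.

Lemma submod_set0 : submod [set 0].
Proof. by split=> // a u v /= -> ->; rewrite scaler0 addr0. Qed.

Lemma submodI A B : submod A -> submod B -> submod (A `&` B).
Proof.
move=> [A0 hA] [B0 hB]; split=> // a u v [Au Bu] [Av Bv].
by split; [exact: hA | exact: hB].
Qed.

Definition msum A B : set V := [set v | exists x y, [/\ A x, B y & v = x + y]].

Lemma submod_msum A B : submod A -> submod B -> submod (msum A B).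
Proof.
move=> [A0 hA] [B0 hB]; split; first by exists 0, 0; rewrite addr0.
move=> a _ _ [u [v [Au Bv ->]]] [u' [v' [Au' Bv' ->]]].
exists (a *: u + u'), (a *: v + v'); split; [exact: hA | exact: hB |].
by rewrite scalerDr addrACA.
Qed.

Lemma sub_msuml A B : submod B -> A `<=` msum A B.
Proof. by move=> [B0 _] u Au; exists u, 0; rewrite addr0. Qed.

Lemma sub_msumr A B : submod A -> B `<=` msum A B.
Proof. by move=> [A0 _] u Bu; exists 0, u; rewrite add0r. Qed.

Lemma msum_sub A B C : submod C -> A `<=` C -> B `<=` C -> msum A B `<=` C.
Proof. by move=> sC AC BC _ [a [b [Aa Bb ->]]]; apply: submodD; auto. Qed.

Definition line s : set V := [set v | exists r, v = r *: s].

Lemma submod_line s : submod (line s).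
Proof.
split; first by exists 0; rewrite scale0r.
by move=> a _ _ [r ->] [r' ->]; exists (a * r + r'); rewrite scalerDl scalerA.
Qed.

Lemma mem_line s : line s s. Proof. by exists 1; rewrite scale1r. Qed.

Definition mspan n (g : 'I_n -> V) : set V :=
  [set v | exists a : 'I_n -> R, v = \sum_i a i *: g i].

Lemma submod_span n (g : 'I_n -> V) : submod (mspan g).
Proof.
split; first by exists (fun=> 0); rewrite big1 // => i _; rewrite scale0r.
move=> r _ _ [a ->] [b ->]; exists (fun i => r * a i + b i).
by rewrite scaler_sumr -big_split; apply: eq_bigr => i _; rewrite scalerDl scalerA.
Qed.

Lemma mem_span n (g : 'I_n -> V) i : mspan g (g i).
Proof.
exists (fun j => (j == i)%:R); rewrite (bigD1 i) //= eqxx scale1r big1 ?addr0 //.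
by move=> j /negPf ->; rewrite scale0r.
Qed.

Lemma span_sub n (g : 'I_n -> V) A : submod A -> (forall i, A (g i)) ->
  mspan g `<=` A.
Proof. by move=> sA Ag _ [a ->]; apply: submod_sum => // i _; apply: submodZ. Qed.

(** The annihilator of s modulo A: (A + Rs)/A is isomorphic to R/(A:s). This stands in for quotient
    modules. *)
Definition colon A s : set R^o := [set r : R | A (r *: s)].

Definition smul r A : set V := [set r *: v | v in A].

Lemma submod_smul r A : submod A -> submod (smul r A).
Proof.
move=> [A0 hA]; split; first by exists 0; rewrite ?scaler0.
move=> a _ _ [u Au <-] [v Av <-]; exists (a *: u + v); first exact: hA.
by rewrite scalerDr !scalerA mulrC.
Qed.

Lemma smul_sub r A : submod A -> smul r A `<=` A.
Proof. by move=> sA _ [v Av <-]; apply: submodZ. Qed.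

End Submodules.

Lemma submod_colon (R : comNzRingType) (V : lmodType R) (A : set V) s :
  submod A -> submod (colon A s).
Proof.
move=> [A0 hA]; split; first by rewrite /colon /= scale0r.
by move=> a u v Au Av; rewrite /colon /= scalerDl -scalerA; apply: hA.
Qed.

Section Ideals.
Variable R : comNzRingType.
Implicit Types (I J N P : set R^o) (a b r : R).

Lemma idealM I a r : submod I -> I r -> I (a * r).
Proof. by move=> sI; exact: (@submodZ _ R^o). Qed.

Lemma idealMr I a r : submod I -> I r -> I (r * a).
Proof. by rewrite mulrC; exact: idealM. Qed.

Lemma ideal1 I : submod I -> I 1 -> I = setT.
Proof.
move=> sI I1; apply/seteqP; split=> // r _.
by rewrite -[r]mulr1; apply: idealM.
Qed.

Definition prime_set P :=
  [/\ submod P, ~ P 1 & forall a b, P (a * b) -> P a \/ P b].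

Section IdealPred.
Variable I : set R^o.

Definition ideal_pred (sI : submod I) (I1 : ~ I 1) : {pred R} :=
  fun x => `[< I x >].

Variables (sI : submod I) (I1 : ~ I 1).

Fact ideal_pred_closed : idealr_closed (ideal_pred sI I1).
Proof.
split; first by apply/asboolP; exact: submod0 sI.
  by apply/negP => /asboolP.
move=> a u v /asboolP Iu /asboolP Iv; apply/asboolP.
by case: sI => _; apply.
Qed.

HB.instance Definition _ := isIdealr.Build R (ideal_pred sI I1) ideal_pred_closed.
End IdealPred.

Section PrimePred.
Variables (P : set R^o).

Definition prime_pred (pP : prime_set P) : {pred R} := fun x => `[< P x >].

Variable pP : prime_set P.

Fact prime_pred_closed : idealr_closed (prime_pred pP).
Proof.
have [sI I1 _] := pP; split; first by apply/asboolP; exact: submod0 sI.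
  by apply/negP => /asboolP.
move=> a u v /asboolP Iu /asboolP Iv; apply/asboolP.
by case: sI => _; apply.
Qed.

Fact prime_pred_prime : prime_idealr_closed (prime_pred pP).
Proof.
have [_ _ h] := pP => u v /asboolP /h hor.
by apply/orP; case: hor => ?; [left|right]; apply/asboolP.
Qed.

HB.instance Definition _ := isIdealr.Build R (prime_pred pP) prime_pred_closed.
HB.instance Definition _ :=
  isPrimeIdealrClosed.Build R (prime_pred pP) prime_pred_prime.

End PrimePred.

Definition prime_of P (pP : prime_set P) : prime_idealr R := prime_pred pP.

Lemma prime_ofE P (pP : prime_set P) x : (x \in prime_of pP) = `[< P x >].
Proof. by []. Qed.

Lemma idealr_submod (I : idealr R) : submod [set x : R^o | x \in I].
Proof.
split; first exact: idealr0.
by move=> a u v Iu Iv; apply: rpredD => //; apply: ring_quotient.idealMr.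
Qed.

Lemma prime_idealr_set (P : prime_idealr R) : prime_set [set x : R^o | x \in P].
Proof.
split; [exact: idealr_submod | by rewrite /= idealr1 |].
by move=> a b /=; rewrite prime_idealrM => /orP.
Qed.

Hypothesis R_noetherian : noetherian R.

Lemma ideal_fg I : submod I -> exists n (g : 'I_n -> R^o), I = mspan g.
Proof.
move=> sI; case: (pselect (I 1)) => I1.
  exists 1, (fun=> 1); rewrite (ideal1 sI I1); apply/seteqP; split=> // r _.
  by exists (fun=> r); rewrite big_ord1 [_ *: _]mulr1.
have [n [g hg]] := R_noetherian (ideal_pred sI I1).
exists n, g; apply/seteqP; split=> r.
  by move=> Ir; apply/hg/asboolP.
by move=> /hg /asboolP.
Qed.

(** A counterexample always has a strictly larger one above it; the union of the resulting chain is
    finitely generated, hence equal to one of its terms, which is absurd. *)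
Lemma noeth_ind (T : set R^o -> Prop) :
  (forall I, submod I ->
    (forall J, submod J -> I `<=` J -> ~ J `<=` I -> T J) -> T I) ->
  forall I, submod I -> T I.
Proof.
move=> hT I0 sI0; apply: contrapT => nT0.
pose bad I := submod I /\ ~ T I.
have /choice[F hF] : forall I, exists J, bad I ->
    [/\ bad J, I `<=` J & ~ J `<=` I].
  move=> I; case: (pselect (bad I)) => [[sI nTI]|nb]; last by exists I.
  apply: contrapT => hJ; apply/nTI/(hT _ sI) => J sJ IJ JI.
  by apply: contrapT => nTJ; apply: hJ; exists J.
pose C n := iter n F I0.
have bC n : bad (C n) by elim: n => // n /hF[].
have leC n k : C n `<=` C (n + k)%N.
  elim: k => [|k ih]; first by rewrite addn0.
  by rewrite addnS; apply: (subset_trans ih); case: (hF _ (bC (n + k)%N)).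
have leC' n k : (n <= k)%N -> C n `<=` C k by move=> /subnKC <-; exact: leC.
pose U : set R^o := [set r | exists n, C n r].
have sU : submod U.
  split; first by exists 0%N; exact: submod0 sI0.
  move=> a u v [n Cu] [k Cv]; exists (maxn n k).
  have [[_ h] _] := bC (maxn n k).
  by apply: h; [apply: leC' Cu; exact: leq_maxl | apply: leC' Cv; exact: leq_maxr].
have [n [g gU]] := ideal_fg sU.
have Ug i : U (g i) by rewrite gU; exact: mem_span.
have [k hk] := choice Ug.
pose K := \max_i k i.
have : U `<=` C K.
  rewrite gU; apply: span_sub; first by case: (bC K).
  by move=> i; apply: leC' (hk i); exact: leq_bigmax.
move=> UC; case: (hF _ (bC K)) => _ _; apply => r hr; apply: UC.
by exists K.+1.
Qed.

(* An ideal that is not prime is controlled by its strictly larger sum and    *)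
(* colon ideals, as in the exact sequence 0 -> R/(N:a) -> R/N -> R/(N+aR).    *)
Lemma prime_ind (T : set R^o -> Prop) :
  T setT -> (forall P, prime_set P -> T P) ->
  (forall N (a : R^o), submod N ->
    T (msum N (line a)) -> T (colon N a) -> T N) ->
  forall N, submod N -> T N.
Proof.
move=> T1 TP TN; apply: noeth_ind => I sI ih.
case: (pselect (I 1)) => I1; first by rewrite (ideal1 sI I1).
case: (pselect (prime_set I)) => [/TP//|nP].
have [a [b [Iab nIa nIb]]] : exists a b, [/\ I (a * b), ~ I a & ~ I b].
  apply: contrapT => h; apply: nP; split=> // a b Iab.
  case: (pselect (I a)) => Ia; [by left | right].
  by apply: contrapT => Ib; apply: h; exists a, b.
apply: (TN _ a sI); apply: ih.
- by apply: submod_msum => //; exact: submod_line.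
- by apply: sub_msuml; exact: submod_line.
- by move=> h; apply/nIa/h/sub_msumr => //; exact: mem_line.
- exact: submod_colon.
- by move=> r Ir; exact: idealMr.
- by move=> h; apply/nIb/h; rewrite /colon /= [_ *: _]mulrC.
Qed.

(** An ideal I maximal among those avoiding M is prime: if a and b lie outside it, M contains some i
    + ra and j + tb with i, j in I, and their product would lie in I if ab did. *)
Lemma prime_avoiding (I : set R^o) (M : set R) :
  submod I -> M 1 -> (forall a b, M a -> M b -> M (a * b)) ->
  (forall r, M r -> ~ I r) ->
  exists P, [/\ prime_set P, I `<=` P & forall r, M r -> ~ P r].
Proof.
move=> sI M1 MM; move: I sI; apply: noeth_ind => I sI ih MI.
case: (pselect (exists J, [/\ submod J, I `<=` J, ~ J `<=` I &
    forall r, M r -> ~ J r])) => [[J [sJ IJ JI MJ]]|hmax].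
  have [P [pP JP MP]] := ih J sJ IJ JI MJ.
  by exists P; split=> //; exact: subset_trans JP.
exists I; split=> //; split=> //; first exact: MI.
have meet a : ~ I a -> exists r i, [/\ M (i + r * a) & I i].
  move=> nIa; apply: contrapT => h; apply: hmax; exists (msum I (line (a : R^o))).
  split; first by apply: submod_msum => //; exact: submod_line.
  - by apply: sub_msuml; exact: submod_line.
  - by move=> hs; apply/nIa/hs/sub_msumr => //; exact: mem_line.
  move=> w Mw [i [_ [Ii [r ->] e]]]; apply: h; exists r, i.
  by split=> //; move: Mw; rewrite e.
move=> a b Iab; apply: contrapT => /not_orP[/meet[r [i [Mi Ii]]]].
move=> /meet[t [j [Mj Ij]]]; apply: (MI _ (MM _ _ Mi Mj)).
rewrite mulrDl !mulrDr mulrACA.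
by apply: (@submodD _ R^o) => //; apply: (@submodD _ R^o) => //;
  by [exact: idealMr | exact: idealM].
Qed.

End Ideals.

(** * Local rings and Krull dimension at most one *)

Section LocalRing.
Variables (R : idomainType) (m : idealr R).
Hypotheses (R_noetherian : noetherian R) (R_local : local_with m).
Implicit Types (I J P : set R^o) (r x y : R).

Lemma proper_sub_max I : submod I -> ~ I 1 -> forall x, I x -> x \in m.
Proof.
move: I; apply: (noeth_ind R_noetherian) => I sI ih I1.
case: (pselect (exists J, [/\ submod J, I `<=` J, ~ J `<=` I & ~ J 1])).
  by move=> [J [sJ IJ JI J1]] x /IJ; apply: ih JI _ _.
move=> hmax; have [_ hm] := R_local.
have Imax : maximal_ideal (ideal_pred sI I1).
  move=> K IK x Kx; apply: contrapT => nIx; apply: hmax.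
  exists [set x : R^o | x \in K]; split; first exact: idealr_submod.
  - by move=> u Iu /=; apply: IK; apply/asboolP.
  - by move=> /(_ x Kx) Ix; apply: nIx; apply/asboolP.
  - by rewrite /= idealr1.
by move=> x Ix; rewrite -(hm _ Imax); apply/asboolP.
Qed.

Lemma local_inv r : r \notin m -> exists s, s * r = 1.
Proof.
move=> rm; apply: contrapT => h.
suff : r \in m by apply/negP.
apply: (proper_sub_max (submod_line (r : R^o))); last exact: mem_line.
by move=> [s e]; apply: h; exists s.
Qed.

Lemma max_prime : prime_set [set x : R^o | x \in m].
Proof.
split; [exact: idealr_submod | by rewrite /= idealr1 |].
move=> a b /= abm; have [|/local_inv[s sa]] := boolP (a \in m); first by left.
by right; rewrite -[b]mul1r -sa -mulrA; apply: ring_quotient.idealMr.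
Qed.

Lemma prime_sub_max P x : prime_set P -> P x -> x \in m.
Proof. by move=> [sP P1 _]; apply: proper_sub_max. Qed.

Fact zero_prime : prime_set [set x : R^o | x = 0].
Proof.
split; first by split=> // a u v /= -> ->; rewrite scaler0 addr0.
  by move=> /eqP; rewrite oner_eq0.
by move=> a b /= /eqP; rewrite mulf_eq0 => /orP[] /eqP; [left|right].
Qed.

(** As 0 is prime, a nonzero prime missing an element of [m] lies strictly between 0 and [m].
    Conversely, the middle term of a chain of three primes has a nonzero element, so it contains [m]
    and hence the third. *)
Lemma dim_le1P : krull_dim_le R 1 <->
  forall P x y, prime_set P -> P x -> x != 0 -> y \in m -> P y.
Proof.
split=> [hdim P x y pP Px x0 ym|h n p hp].
  apply: contrapT => nPy.
  pose p k := if k is k'.+1 then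
    (if k' is 0%N then prime_of pP else prime_of max_prime) else prime_of zero_prime.
  suff /hdim : prime_chain 2 p by [].
  move=> [|[|//]] _ /=; split.
  - by move=> u /asboolP /= ->; apply/asboolP; have [/submod0] := pP.
  - by move=> /(_ x); rewrite !prime_ofE => /(_ (asboolT Px)) /asboolP /eqP; apply/negP.
  - by move=> u /asboolP /= Pu; apply/asboolP; exact: (prime_sub_max pP).
  - by move=> /(_ y); rewrite !prime_ofE => /(_ (asboolT ym)) /asboolP.
rewrite leqNgt; apply/negP => n2.
have [s01 n10] := hp 0%N (ltnW n2); have [s12 n21] := hp 1%N n2.
apply: n21 => y y2.
have [x x1 x0] : exists2 x, x \in p 1%N & x \notin p 0%N.
  apply: contrapT => hx; apply: n10 => x x1; apply: contrapT => /negP x0.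
  by apply: hx; exists x.
apply: (h _ x y (prime_idealr_set (p 1%N)) x1).
  by apply: contraNneq x0 => ->; exact: idealr0.
exact: (prime_sub_max (prime_idealr_set (p 2%N))).
Qed.

Lemma dim_gt1P : ~ krull_dim_le R 1 ->
  exists P x y, [/\ prime_set P, P x, x != 0, y \in m & ~ P y].
Proof.
move=> /dim_le1P h; apply: contrapT => hn; apply: h => P x y pP Px x0 ym.
by apply: contrapT => nPy; apply: hn; exists P, x, y.
Qed.

End LocalRing.

(** * Injective modules *)

Section SubmoduleType.
Variables (R : comNzRingType) (V : lmodType R) (A : set V) (sA : submod A).

Definition subm_pred of submod A : {pred V} := fun v => `[< A v >].

Record subm := Subm { subm_val : V; _ : subm_val \in subm_pred sA }.

HB.instance Definition _ := [isSub for subm_val].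
HB.instance Definition _ := [Choice of subm by <:].

Fact subm_pred_closed : submod_closed (subm_pred sA).
Proof.
by case: (sA) => A0 hA; split=> [|a u v /asboolP Au /asboolP Av];
  apply/asboolP; [exact: A0 | exact: hA].
Qed.

HB.instance Definition _ :=
  GRing.isSubmodClosed.Build R V (subm_pred sA) subm_pred_closed.
HB.instance Definition _ := [SubChoice_isSubLmodule of subm by <:].

Lemma submP (v : subm) : A (val v). Proof. by case: v => v /= /asboolP. Qed.

Definition insubm v (Av : A v) : subm := Subm (asboolT Av : v \in subm_pred sA).

Lemma subm_eq (u v : subm) : val u = val v -> u = v. Proof. exact: val_inj. Qed.

End SubmoduleType.
Arguments subm {R V A} sA.
Arguments insubm {R V A sA v} Av.

Section Injective.
Variable R : comNzRingType.

Definition lin (U V : lmodType R) (f : U -> V) (fl : linear f) : {linear U -> V} :=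
  HB.pack f (GRing.isLinear.Build R U V *:%R f fl).

(* A submodule of V x E meeting 0 x E trivially is the graph of a map on its  *)
(* first projection; stating the extension property with graphs avoids        *)
(* choosing this map.                                                         *)
Lemma injective_graph (V E : lmodType R) (G : set (V * E)%type) :
  injective_module E -> submod G -> (forall e, G (0, e) -> e = 0) ->
  exists g : {linear V -> E}, forall v e, G (v, e) -> g v = e.
Proof.
move=> injE sG G0.
have l1 : linear (fun x : subm sG => (val x).1) by [].
have l2 : linear (fun x : subm sG => (val x).2) by [].
have [|g hg] := injE _ _ (lin l1) (lin l2).
  move=> x y e; apply: subm_eq.
  have {e}: (val x).1 = (val y).1 := e.
  move: (val x) (val y) (submP x) (submP y) => [a b] [c d] Gx Gy /= e.
  have : G (0, b - d).
    by rewrite (_ : (0, _) = (a, b) - (c, d));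
      [exact: submodB | rewrite e -[0](subrr c)].
  by move=> /G0/eqP; rewrite subr_eq0 e => /eqP ->.
exists g => v e Gve; exact: (hg (insubm Gve)).
Qed.

End Injective.

Section Divisible.
Variables (R : idomainType) (D : lmodType R).
Hypotheses (D_tf : torsion_free D).
Hypothesis D_div : forall (r : R) (v : D), r != 0 -> exists w, v = r *: w.

Let functional (B : lmodType R) (G : set (B * D)%type) :=
  submod G /\ forall e, G (0, e) -> e = 0.

(** If a nonzero multiple r b already has the value d', divisibility offers d with d' = r d, and
    torsion-freeness makes this choice consistent. Otherwise d = 0 will do. *)
Lemma functional_extend (B : lmodType R) (G : set (B * D)%type) (b : B) :
  functional G -> exists d, functional (msum G (line (b, d))).
Proof.
move=> [sG G0].
have sGl d : submod (msum G (line (b, d))).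
  by apply: submod_msum => //; exact: submod_line.
have key d e : msum G (line (b, d)) (0, e) ->
    exists t, G (t *: b, t *: d - e).
  move=> [[x y] [_ [Gxy [t ->] [/eqP]]]].
  rewrite eq_sym addr_eq0 => /eqP xe ->; exists t.
  rewrite (_ : (_, _) = - (x, y)); first exact: submodN.
  by rewrite xe -[RHS]/(_, _) /= opprK opprD addrCA subrr addr0.
case: (pselect (exists r d', r != 0 /\ G (r *: b, d'))) => [[r [d' [r0 Gr]]]|hG].
  have [d dd'] := D_div d' r0; exists d; split=> // e /key[t Gt].
  have := submodB sG (submodZ r sG Gt) (submodZ t sG Gr).
  rewrite (_ : _ - _ = (0, - (r *: e))).
    by move=> /G0/eqP; rewrite oppr_eq0 => /eqP /D_tf[/eqP|//]; rewrite (negPf r0).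
  rewrite -[LHS]/(_, _) /= dd' scalerBr !scalerA mulrC subrr.
  by rewrite addrAC subrr add0r.
exists 0; split=> // e /key[t Gt]; have [t0|t0] := eqVneq t 0.
  by move: Gt; rewrite t0 !scale0r sub0r => /G0/eqP; rewrite oppr_eq0 => /eqP.
by case: hG; exists t, (t *: 0 - e).
Qed.

Lemma divisible_injective : injective_module D.
Proof.
move=> A B i f inji.
pose G0 : set (B * D)%type := [set p | exists a, p = (i a, f a)].
have fG0 : functional G0.
  split; last first.
    by move=> e [a [ia ->]]; rewrite (_ : a = 0) ?linear0 //; apply: inji;
      rewrite -ia linear0.
  split; first by exists 0; rewrite !linear0.
  by move=> a _ _ [u ->] [v ->]; exists (a *: u + v); rewrite !linearP.
(* Adjoining [G0] makes the union of the empty chain admissible for Zorn's lemma. *)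
pose P := [set X | functional (G0 `|` X)].
have [F FP Ftot|X [[sX X0] Xmax]] := Zorn_bigcup (P := P).
  have FG u v : (G0 `|` \bigcup_(X in F) X) u -> (G0 `|` \bigcup_(X in F) X) v ->
      exists Y, [/\ functional Y, Y u, Y v & Y `<=` G0 `|` \bigcup_(X in F) X].
    have sub Y : F Y -> G0 `|` Y `<=` G0 `|` \bigcup_(X in F) X.
      by move=> FY; apply: setUS; exact: bigcup_sup.
    move=> [Gu|[Y FY Yu]] [Gv|[Z FZ Zv]].
    - by exists G0; split=> //; exact: subsetUl.
    - by exists (G0 `|` Z); split; [exact: FP| left | right | exact: sub].
    - by exists (G0 `|` Y); split; [exact: FP| right | left | exact: sub].
    - case: (Ftot Y Z FY FZ) => YZ.
        by exists (G0 `|` Z); split; [exact: FP| right; exact: YZ | right | exact: sub].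
      by exists (G0 `|` Y); split; [exact: FP| right | right; exact: YZ | exact: sub].
  split; last by move=> e he; have [Y [[_ Y0] /Y0]] := FG _ _ he he.
  split; first by left; exact: submod0 fG0.1.
  move=> a u v hu hv; have [Y [[[_ h] _] Yu Yv YF]] := FG _ _ hu hv.
  by apply: YF; apply: h.
set G := G0 `|` X in sX X0.
have dom b : exists d, G (b, d).
  have [d [sG' G'0]] := functional_extend b (conj sX X0).
  set G' := msum G _ in sG' G'0; have GG' : G `<=` G' by exact/sub_msuml/submod_line.
  exists d; have Xb : G' (b, d) by apply: sub_msumr => //; exact: mem_line.
  apply: contrapT => nG; apply: (Xmax G').
    split; first by apply: (subset_trans _ GG'); exact: subsetUr.
    by move=> /(_ _ Xb) ?; apply: nG; right.
  by rewrite /P /= (_ : _ `|` _ = G') //; apply/setUidr; apply: (subset_trans _ GG');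
    exact: subsetUl.
have [g Gg] := choice dom.
have uniqG b d d' : G (b, d) -> G (b, d') -> d = d'.
  move=> Gd Gd'; apply/eqP; rewrite -subr_eq0; apply/eqP/X0.
  by rewrite -(subrr b); apply: (submodB sX Gd Gd').
have gl : linear g.
  move=> a u v; apply: (uniqG _ _ _ (Gg _)).
  by case: sX => _ /(_ a _ _ (Gg u) (Gg v)).
exists (lin gl) => a /=; apply: uniqG (Gg _) _.
by left; exists a.
Qed.

End Divisible.

Section Cogenerator.
Variables (R : idomainType) (m : idealr R).
Hypotheses (R_noetherian : noetherian R) (R_local : local_with m).
Variables (E : lmodType R) (i : {linear {ideal_quot m} -> E}).
Hypothesis E_envelope : is_injective_envelope i.

Lemma pi_scale (r : R) (x : {ideal_quot m}) : r *: x = \pi_{ideal_quot m} r * x.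
Proof. by []. Qed.

Lemma pi_eq0 r : (\pi_{ideal_quot m} r == 0) = (r \in m).
Proof. by rewrite -[0](rmorph0 (\pi_{ideal_quot m})) -Quotient.idealrBE subr0. Qed.

(** The ideal (A:z) is proper, hence inside [m], so a + r z |-> i(r mod m) is well defined on A +
    Rz. It extends to V because E is injective. *)
Lemma cogenerator (V : lmodType R) (A : set V) z : submod A -> ~ A z ->
  exists f : {linear V -> E}, (forall a, A a -> f a = 0) /\ f z != 0.
Proof.
move=> sA nAz; have [injE inji _] := E_envelope.
pose G : set (V * E)%type :=
  [set p | exists a r, A a /\ p = (a + r *: z, i (\pi r))].
have [|e [a [r [Aa [az ->]]]]|f hf] := injective_graph (G := G) injE.
- split; first by exists 0, 0; rewrite scale0r addr0 !raddf0; split=> //;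
  exact: submod0.
  move=> b _ _ [a [r [Aa ->]]] [a' [r' [Aa' ->]]].
  exists (b *: a + a'), (b * r + r'); split; first by case: sA => _; apply.
  rewrite -[LHS]/(b *: (a + r *: z) + (a' + r' *: z), b *: i (\pi r) + i (\pi r')).
  congr pair; first by rewrite scalerDr scalerDl scalerA addrACA.
  by rewrite rmorphD rmorphM -pi_scale linearD linearZ.
- have : r \in m.
    apply: (proper_sub_max R_noetherian R_local (submod_colon z sA)).
      by rewrite /colon /= scale1r.
    rewrite /colon /= -[_ *: _]opprK; apply: submodN => //.
    by move/esym/eqP: az; rewrite addr_eq0 => /eqP <-.
  by rewrite -pi_eq0 => /eqP ->; rewrite linear0.
exists f; split=> [a Aa|].
  by apply: hf; exists a, 0; rewrite scale0r addr0 !raddf0.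
rewrite (hf z (i 1)); last first.
  by exists 0, 1; rewrite scale1r add0r rmorph1; split=> //; exact: submod0.
by rewrite -(linear0 i) (inj_eq inji) oner_eq0.
Qed.

End Cogenerator.

(** * Rank and embeddings *)

Local Notation "r %:F" := (@FracField.tofrac _ r).

Section Fractions.
Variable R : idomainType.
Local Notation Q := {fraction R}.
Implicit Types (a b r : R) (q : Q).

Lemma tofrac_inj : injective (@FracField.tofrac R).
Proof. by move=> a b /eqP; rewrite tofrac_eq => /eqP. Qed.

Lemma tofrac_neq0 r : r != 0 -> r%:F != 0 :> Q.
Proof. by rewrite tofrac_eq0. Qed.

Lemma frac_scaleE r q : r *: q = r%:F * q. Proof. by []. Qed.

Lemma fracP q : exists a b, b != 0 /\ q = a%:F / b%:F.
Proof.
elim/quotW: q => x; exists \n_x, \d_x; split; first exact: denom_ratioP.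
have d0 : (\d_x)%:F != 0 :> Q by rewrite tofrac_neq0 // denom_ratioP.
apply: (mulIf d0); rewrite mulfVK //; unlock FracField.tofrac.
rewrite -[LHS]FracField.pi_mul; apply/eqmodP; rewrite /= FracField.equivfE.
rewrite /FracField.mulf !numden_Ratio ?oner_neq0 ?mulf_neq0 ?denom_ratioP //.
all: by rewrite ?oner_neq0 // !mulr1 mulrC.
Qed.

Lemma frac_tf : torsion_free Q.
Proof.
by move=> r q /eqP; rewrite mulf_eq0 tofrac_eq0 => /orP[] /eqP; [left|right].
Qed.

End Fractions.

Section Tensor.
Variables (R : idomainType) (S : lmodType R).
Local Notation Q := {fraction R}.
Implicit Types (l : seq (Q * S)) (d e r : R).

Definition tensor1 (s : S) : frac_tensor S := \pi_(frac_tensor S) [:: (1, s)].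

Lemma pi_tensor1 r s : \pi_(frac_tensor S) [:: (r%:F, s)] = tensor1 (r *: s).
Proof. by rewrite -[_%:F]mulr1; apply/pi_tensorP; exact: TensorBalanced. Qed.

Lemma pi_tensorZ q l : q *: \pi_(frac_tensor S) l = \pi_(frac_tensor S) (scale_pairs q l).
Proof. exact: pi_tensor_scale. Qed.

Lemma tensor1_linear r u v : tensor1 (r *: u + v) = r%:F *: tensor1 u + tensor1 v.
Proof.
rewrite /tensor1 pi_tensorZ /= mulr1 pi_tensor1 -pi_tensorD.
by apply/pi_tensorP; exact: TensorAddr.
Qed.

Lemma tensor1Z r u : tensor1 (r *: u) = r%:F *: tensor1 u.
Proof. by rewrite /tensor1 pi_tensorZ /= mulr1 pi_tensor1. Qed.

Lemma tensor1D u v : tensor1 (u + v) = tensor1 u + tensor1 v.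
Proof. by rewrite -[u]scale1r tensor1_linear tofrac1 !scale1r. Qed.

Lemma tensor_denom (t : frac_tensor S) :
  exists d s, d != 0 /\ d%:F *: t = tensor1 s.
Proof.
have [l ->] := pi_tensor_surj t; elim: l => [|[q s] l [d [s' [d0 e]]]].
  exists 1, 0; split; first exact: oner_neq0.
  by rewrite pi_tensorZ -[0 in RHS](scale0r (0 : S)) -pi_tensor1;
    apply/esym/pi_tensorP; exact: TensorZero.
have [a [b [b0 ->]]] := fracP q.
exists (b * d), ((d * a) *: s + b *: s'); split; first exact: mulf_neq0.
rewrite -cat1s pi_tensorD scalerDr tensor1D; congr (_ + _).
  rewrite pi_tensorZ /= -pi_tensor1; congr (\pi [:: (_, _)]).
  by rewrite !tofracM [b%:F * _]mulrC -mulrA [b%:F * _]mulrCA mulfV ?mulr1 ?tofrac_neq0.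
by rewrite tofracM -scalerA e tensor1Z.
Qed.

Hypothesis S_tf : torsion_free S.

(** For d clearing the denominators of l, [cleared d l] is d times the tensor l, computed in S
    itself. It is the invariant that shows s |-> 1 (x) s to be injective. The default 0 is taken
    when d q is not in R. *)
Definition num d (q : Q) : R := xget 0 [set r | r%:F = d%:F * q].
Definition clears d l := forall p, p \in l -> exists r, r%:F = d%:F * p.1.
Definition cleared d l : S := \sum_(p <- l) num d p.1 *: p.2.

Lemma num_eq d q r : r%:F = d%:F * q -> num d q = r.
Proof.
by rewrite /num => h; case: xgetP => [x _ /= hx|/(_ r)]//; apply: tofrac_inj;
  rewrite hx.
Qed.

Lemma clears_cat d l1 l2 : clears d (l1 ++ l2) -> clears d l1 /\ clears d l2.
Proof. by move=> h; split=> p pl; apply: h; rewrite mem_cat pl ?orbT. Qed.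

Lemma clearsM d e l : clears d l -> clears (e * d) l.
Proof. by move=> h p /h[r hr]; exists (e * r); rewrite !tofracM hr mulrA. Qed.

Lemma clearedM d e l : clears d l -> cleared (e * d) l = e *: cleared d l.
Proof.
move=> h; rewrite /cleared scaler_sumr; apply: eq_big_seq => p /h[r hr].
by rewrite (num_eq hr) (num_eq (r := e * r)) ?scalerA // !tofracM hr mulrA.
Qed.

Lemma clears_ex l : exists2 d, d != 0 & clears d l.
Proof.
elim: l => [|[q s] l [d d0 hd]]; first by exists 1; rewrite ?oner_neq0.
have [a [b [b0 ->]]] := fracP q; exists (d * b); first exact: mulf_neq0.
move=> p; rewrite inE => /orP[/eqP->|pl].
  by exists (d * a); rewrite !tofracM mulrA mulrAC mulfK ?tofrac_neq0.
by rewrite [d * b]mulrC; apply: (clearsM _ hd).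
Qed.

(** By induction on the derivation. In the transitive case d need not clear the middle list; a
    further factor e does, and is cancelled because S is torsion-free. *)
Lemma cleared_rel l1 l2 d : tensor_rel l1 l2 -> d != 0 ->
  clears d l1 -> clears d l2 -> cleared d l1 = cleared d l2.
Proof.
move=> h; elim: h d => {l1 l2} [l|l1 l2 _ ih|l1 l2 l3 _ h1 _ h2
  |l1 l2 l1' l2' _ h1 _ h2|l1 l2|s|q1 q2 s|q s1 s2|a q s] d d0 c1 c2 //.
- by rewrite ih.
- have [e e0 ce] := clears_ex l2.
  have : e *: (cleared d l1 - cleared d l3) = 0.
    apply/eqP; rewrite scalerBr subr_eq0 -!clearedM //; apply/eqP.
    have cde : clears (e * d) l2 by rewrite mulrC; exact: clearsM.
    by rewrite h1 ?mulf_neq0 // 1?h2 ?mulf_neq0 //; exact: clearsM.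
  by move=> /S_tf[/eqP|/eqP]; [rewrite (negPf e0) | rewrite subr_eq0 => /eqP].
- have [c11 c12] := clears_cat c1; have [c21 c22] := clears_cat c2.
  by rewrite /cleared !big_cat /= -!/(cleared _ _) h1 ?h2.
- by rewrite /cleared !big_cat /= addrC.
- rewrite /cleared big_nil big_seq1 (num_eq (r := 0)) ?scale0r //.
  by rewrite mulr0 tofrac0.
- have [r hr] := c2 (q1, s) (mem_head _ _).
  have [|r' hr'] := c2 (q2, s); first by rewrite !inE eqxx orbT.
  rewrite /cleared !big_cons big_nil addr0 (num_eq (r := r + r')) /=; last first.
    by rewrite tofracD hr hr' mulrDr.
  by rewrite (num_eq hr) (num_eq hr') scalerDl addr0.
- by rewrite /cleared !big_cons big_nil !addr0 scalerDr.
- have [r hr] := c2 _ (mem_head _ _).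
  rewrite /cleared !big_seq1 (num_eq (r := r * a)) /= ?(num_eq hr) ?scalerA //.
  by rewrite tofracM hr frac_scaleE mulrAC mulrA.
Qed.

Lemma tensor1_inj : injective tensor1.
Proof.
move=> u v /pi_tensorP /cleared_rel /(_ (oner_neq0 _)).
have c w : clears 1 [:: (1 : Q, w : S)].
  by move=> p; rewrite inE => /eqP ->; exists 1; rewrite tofrac1 mulr1.
have n : num 1 1 = 1 by apply: num_eq; rewrite tofrac1 mulr1.
by move=> /(_ (c u) (c v)); rewrite /cleared !big_seq1 /= n !scale1r.
Qed.

(** Coordinates of 1 (x) s in a basis of Q (x) S. The last clause says that the image spans over
    Q. *)
Lemma finite_rank_embedding : finite_rank S ->
  exists n (c : S -> 'rV[Q]_n),
    [/\ forall a u v, c (a *: u + v) = a%:F *: c u + c v,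
        injective c &
        forall v, exists d s, d != 0 /\ d%:F *: v = c s].
Proof.
move=> [n [b hb]]; have /choice[k hk]
  : forall v, exists c : {ffun 'I_n -> Q}, v = \sum_i c i *: b i.
  by move=> v; have [c [? _]] := hb v; exists c.
have k_uniq v c : v = \sum_i c i *: b i -> k v = [ffun i => c i].
  have [c' [_ u]] := hb v.
  move=> e; rewrite -(u _ (hk v)); apply: u; rewrite e.
  by apply: eq_bigr => i _; rewrite ffunE.
pose row v : 'rV[Q]_n := \row_i k v i.
have row_lin q u v : row (q *: u + v) = q *: row u + row v.
  apply/rowP => i; rewrite !mxE (k_uniq _ (fun i => q * k u i + k v i)) ?ffunE //.
  rewrite {1}(hk u) {1}(hk v) scaler_sumr -big_split.
  by apply: eq_bigr => j _; rewrite scalerDl scalerA.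
exists n, (fun s => row (tensor1 s)); split.
- by move=> a u v; rewrite tensor1_linear row_lin.
- move=> u v e; apply: tensor1_inj; rewrite (hk (tensor1 u)) (hk (tensor1 v)).
  by apply: eq_bigr => i _; have /rowP/(_ i) := e; rewrite !mxE => ->.
- move=> v; have [d [s [d0 e]]] := tensor_denom (\sum_i v 0 i *: b i).
  exists d, s; split=> //; rewrite -e; apply/rowP => i; rewrite !mxE.
  rewrite (k_uniq _ (fun i => d%:F * v 0 i)) ?ffunE // scaler_sumr.
  by apply: eq_bigr => j _; rewrite scalerA.
Qed.

End Tensor.

(** The basis is 1 (x) s0: any s has a nonzero multiple in R s0, and the coefficient is unique
    because q (x) s |-> q j(s) respects the tensor relations. *)
Lemma finite_rank1 (R : idomainType) (S : lmodType R) (j : {linear S ->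
  {fraction R}}) (s0 : S) :
  injective j -> s0 != 0 -> finite_rank S.
Proof.
move=> inj_j s00; exists 1%N, (fun=> tensor1 s0) => t.
have j0 : j s0 != 0 by rewrite -(linear0 j) (inj_eq inj_j).
have ev l1 l2 : tensor_rel l1 l2 ->
    \sum_(p <- l1) p.1 * j p.2 = \sum_(p <- l2) p.1 * j p.2.
  elim=> {l1 l2} [l|l1 l2 _ ->|l1 l2 l3 _ -> _ ->|l1 l2 l1' l2' _ h1 _ h2
    |l1 l2|s|q1 q2 s|q s1 s2|a q s] //.
  - by rewrite !big_cat /= h1 h2.
  - by rewrite !big_cat /= addrC.
  - by rewrite big_seq1 big_nil mul0r.
  - by rewrite !big_cons big_nil /= !addr0 mulrDl.
  - by rewrite !big_cons big_nil /= !addr0 linearD mulrDr.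
  - by rewrite !big_seq1 /= linearZ /= !frac_scaleE mulrCA mulrA.
have [d [s [d0 e]]] := tensor_denom t.
have [a [b [b0 ab]]] := fracP (j s / j s0).
have bs : b *: s = a *: s0.
  apply: inj_j; rewrite !linearZ /= !frac_scaleE -[j s](mulfVK j0) ab.
  by rewrite !mulrA [_%:F * a%:F]mulrC mulfK ?tofrac_neq0.
exists [ffun=> (a%:F / b%:F) / d%:F]; split.
  rewrite big_ord1 ffunE; apply: (scalerI (tofrac_neq0 d0)).
  rewrite e scalerA mulrC mulfVK ?tofrac_neq0 //.
  apply: (scalerI (tofrac_neq0 b0)).
  by rewrite scalerA mulrC mulfVK ?tofrac_neq0 // -!tensor1Z bs.
move=> c'; rewrite big_ord1 => te; apply/ffunP => k; rewrite ord1 ffunE.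
have : \pi_(frac_tensor S) [:: (d%:F * c' ord0, s0)] = tensor1 s.
  by rewrite -e te scalerA pi_tensorZ /= mulr1.
move=> /pi_tensorP/ev; rewrite !big_seq1 mul1r /=.
move=> h; apply: (mulfI (tofrac_neq0 d0)); apply: (mulIf j0).
by rewrite h -ab [_ * (_ / _)]mulrC mulfVK ?tofrac_neq0 // mulfVK.
Qed.

(** * Length *)

Section Length.
Variables (R : comNzRingType) (V : lmodType R).
Implicit Types (A B N : set V) (C D : nat -> set V) (k n : nat) (s v : V).

Definition mchain C B A :=
  forall k, [/\ submod (C k), B `<=` C k, C k `<=` A & C k `<=` C k.+1].

Definition steps C k := (\sum_(i < k) `[< ~ C i.+1 `<=` C i >])%N.

(* Chains are weakly increasing, and only their strict steps are counted:     *)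
(* intersections and sums of chains with a submodule are then chains.         *)
Definition len_le B A n := forall C k, mchain C B A -> (steps C k <= n)%N.

Lemma mchain_sub C B A B' A' : mchain C B A -> B' `<=` B -> A `<=` A' -> mchain C B' A'.
Proof.
move=> hC BB AA k; have [sC BC CA CC] := hC k.
by split=> //; [exact: subset_trans BC | exact: subset_trans AA].
Qed.

Lemma len_le_sub B A n B' A' : len_le B A n -> B `<=` B' -> A' `<=` A -> len_le B' A' n.
Proof. by move=> h BB AA C k hC; apply: h; exact: mchain_sub AA. Qed.

(** A strict step of D stays strict in D [&] B or in D + B, by the modular law. *)
Lemma len_leD B0 B A n n' : submod B -> B0 `<=` B -> B `<=` A -> submod A ->
  len_le B0 B n -> len_le B A n' -> len_le B0 A (n + n').
Proof.
move=> sB B0B BA sA h h' D k hD.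
have c1 : mchain (fun i => D i `&` B) B0 B.
  move=> i; have [sD BD DA DD] := hD i; split; first exact: submodI.
  - by move=> v Bv; split; [exact: BD | exact: B0B].
  - by move=> v [].
  - by move=> v [/DD].
have c2 : mchain (fun i => msum (D i) B) B A.
  move=> i; have [sD BD DA DD] := hD i; split; first exact: submod_msum.
  - exact: sub_msumr.
  - exact: msum_sub.
  - by move=> _ [u [v [/DD Du Bv ->]]]; exists u, v.
apply: leq_trans (leq_add (h _ k c1) (h' _ k c2)).
rewrite /steps -big_split; apply: leq_sum => i _ /=.
case: (asboolP (~ D i.+1 `<=` D i)) => // nD.
case: (asboolP (~ D i.+1 `&` B `<=` _)) => [//|/contrapT h1].
rewrite asboolT // => h2; apply: nD => v Dv.
have [sD _ _ DD] := hD i; have [sD' _ _ _] := hD i.+1.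
have [|u [w [Du Bw vuw]]] := h2 v; first exact: sub_msuml.
rewrite vuw; apply: submodD => //.
suff [] : (D i `&` B) w by [].
apply: h1; split=> //; rewrite (_ : w = v - u); last by rewrite vuw addrAC subrr add0r.
by apply: submodB => //; exact: DD.
Qed.

Lemma mchain_cat C1 C2 B0 B A k1 k2 : B0 `<=` B -> B `<=` A ->
  mchain C1 B0 B -> mchain C2 B A ->
  exists C, mchain C B0 A /\ (steps C1 k1 + steps C2 k2 <= steps C (k1 + k2))%N.
Proof.
move=> B0B BA h1 h2.
exists (fun i => if (i <= k1)%N then C1 i else C2 (i - k1)%N); split=> [i|].
  have [s1 b1 a1 l1] := h1 i; have [s2 b2 a2 l2] := h2 (i - k1)%N.
  have b3 : B `<=` C2 (i.+1 - k1)%N by have [_ ? _ _] := h2 (i.+1 - k1)%N.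
  case: (ltngtP i k1) => hi.
  - by split=> //; exact: subset_trans a1 BA.
  - by rewrite subSn ?(ltnW hi) //; split=> //; exact: subset_trans B0B b2.
  - by split=> //; [exact: subset_trans a1 BA | exact: subset_trans a1 b3].
rewrite /steps big_split_ord /=; apply: leq_add.
  apply: leq_sum => i _ /=; have -> : (i <= k1)%N by exact: ltnW.
  by rewrite ltn_ord.
apply: leq_sum => j _ /=.
have -> : ((k1 + j).+1 <= k1)%N = false by rewrite ltnNge leq_addr.
(* At the seam the step goes from [C1 k1] to [C2 1]; it is strict if the step from [C2 0] is,
   because [C1 k1] lies in B and so in [C2 0]. *)
rewrite -addnS addKn; case: (posnP j) => [->|j0]; last first.
  by have -> : (k1 + j <= k1)%N = false;
    [rewrite leqNgt -[X in (X < _)%N]addn0 ltn_add2l j0 | rewrite addKn].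
rewrite addn0 leqnn; case: (asboolP (~ C2 _ `<=` _)) => // h.
rewrite asboolT // => h'; apply: h; apply: (subset_trans h').
have [_ _ b _] := h1 k1; apply: (subset_trans b).
by have [_ ? _ _] := h2 0%N.
Qed.

Lemma len_exact B A n : submod B -> B `<=` A -> len_le B A n ->
  exists f C k, [/\ len_le B A f, mchain C B A & steps C k = f].
Proof.
move=> sB BA h; have exP : exists f, `[< len_le B A f >] by exists n; apply/asboolP.
case: (ex_minnP exP) => f /asboolP hf fmin.
suff [C [k [hC hk]]] : exists C k, mchain C B A /\ (f <= steps C k)%N.
  by exists f, C, k; split=> //; apply/eqP; rewrite eqn_leq hk hf.
case: f hf fmin => [|f] hf fmin; first by exists (fun=> B), 0%N; split=> // i; split.
apply: contrapT => hn; suff /fmin : `[< len_le B A f >] by rewrite ltnn.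
apply/asboolP => C k hC; rewrite leqNgt; apply/negP => hk; apply: hn.
by exists C, k.
Qed.

End Length.

Lemma steps_le (R : comNzRingType) (V V' : lmodType R)
    (C : nat -> set V) (D : nat -> set V') k :
  (forall i, (i < k)%N -> ~ C i.+1 `<=` C i -> ~ D i.+1 `<=` D i) ->
  (steps C k <= steps D k)%N.
Proof.
move=> h; apply: leq_sum => i _; case: asboolP => // /(h _ (ltn_ord i)) hD.
by rewrite asboolT.
Qed.

Section Adjoin.
Variables (R : comNzRingType) (V : lmodType R).
Implicit Types (A B N : set V) (C D : nat -> set V) (k n : nat) (s v : V).

(** Chains pull back along r |-> r s, which identifies R/(B:s) with (B + Rs)/B. *)
Lemma len_line A B s n : submod B -> A `<=` msum B (line s) ->
  len_le (colon B s) setT n -> len_le B A n.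
Proof.
move=> sB As h C k hC.
have c : mchain (V := R^o) (fun i => colon (C i) s) (colon B s) setT.
  move=> i; have [sC BC CA CC] := hC i; split=> //; first exact: submod_colon.
    by move=> r; exact: BC.
  by move=> r; exact: CC.
apply: leq_trans (h _ k c); apply: steps_le => i _; apply: contra_not => hsub v Cv.
have [sC BC _ _] := hC i; have [sC' BC' CA' _] := hC i.+1.
have [u [_ [Bu [r ->] vur]]] := As _ (CA' _ Cv).
rewrite vur; apply: submodD => //; first exact: BC.
apply: hsub; rewrite /colon /= (_ : r *: s = v - u);
  last by rewrite vur addrAC subrr add0r.
by apply: submodB => //; exact: BC'.
Qed.

Definition adj B (l : seq V) := foldr (fun s A => msum A (line s)) B l.

Lemma submod_adj B l : submod B -> submod (adj B l).
Proof.
by move=> sB; elim: l => //= s l ih; apply: submod_msum => //; exact: submod_line.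
Qed.

Lemma sub_adj B l : B `<=` adj B l.
Proof.
elim: l => //= s l ih; apply: (subset_trans ih).
by apply: sub_msuml; exact: submod_line.
Qed.

Lemma mem_adj B l s : submod B -> s \in l -> adj B l s.
Proof.
move=> sB; elim: l => //= t l ih; rewrite inE => /orP[/eqP ->|/ih h].
  by apply: sub_msumr; [exact: submod_adj | exact: mem_line].
by apply: sub_msuml => //; exact: submod_line.
Qed.

Lemma adj_sub B l A : submod A -> B `<=` A -> (forall s, s \in l -> A s) ->
  adj B l `<=` A.
Proof.
move=> sA BA; elim: l => //= s l ih hl; apply: msum_sub => //.
  by apply: ih => t tl; apply: hl; rewrite inE tl orbT.
by move=> _ [r ->]; apply: submodZ => //; apply: hl; exact: mem_head.
Qed.

Lemma adj_msum B l : submod B -> adj B l `<=` msum B (adj [set 0] l).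
Proof.
have s0 := @submod_set0 _ V; move=> sB; apply: adj_sub.
- by apply: submod_msum => //; exact: submod_adj.
- by apply: sub_msuml; exact: submod_adj.
- by move=> s sl; apply: sub_msumr => //; exact: mem_adj.
Qed.

Lemma adj0_sum l v : adj [set 0] l v ->
  exists a : nat -> R, v = \sum_(i < size l) a i *: l`_i.
Proof.
elim: l v => [|s l ih] v /=; first by move=> ->; exists (fun=> 0); rewrite big_ord0.
move=> [u [_ [/ih[a ->] [r ->] ->]]].
exists (fun i => if i is j.+1 then a j else r).
by rewrite big_ord_recl /= addrC.
Qed.

Lemma len_adj B l (e : V -> nat) : submod B ->
  (forall s, s \in l -> len_le (colon B s) setT (e s)) ->
  len_le B (adj B l) (\sum_(s <- l) e s).
Proof.
move=> sB; elim: l => [|s l ih] hl /=.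
  rewrite big_nil => C k hC; rewrite /steps big1 // => i _.
  apply/eqP; rewrite eqb0; apply/asboolPn => h; apply: h.
  have [_ _ CA _] := hC i.+1; have [_ BC _ _] := hC i.
  exact: subset_trans CA BC.
rewrite big_cons addnC; have sA := submod_adj l sB.
have sAs : adj B l `<=` msum (adj B l) (line s) by apply: sub_msuml; exact: submod_line.
apply: (len_leD sA (sub_adj (B := B) l) sAs).
- by apply: submod_msum => //; exact: submod_line.
- by apply: ih => t tl; apply: hl; rewrite inE tl orbT.
- apply: (len_line (s := s) sA) => //; apply: (len_le_sub (hl s (mem_head _ _))) => //.
  by move=> r; exact: sub_adj.
Qed.

(** Each element of A adjoined to B from outside B uses up a strict step, so at most n of them
    exhaust A. *)
Lemma len_fg B A n : submod B -> submod A -> B `<=` A -> len_le B A n ->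
  exists l, (forall s, s \in l -> A s) /\ A `<=` adj B l.
Proof.
move=> + sA; elim: n B => [|n ih] B sB BA h.
  exists [::]; split=> //= s As; apply: contrapT => nBs.
  pose C k := if k is 0%N then B else A.
  have hC : mchain C B A by case=> [|k]; split.
  by have := h _ 1%N hC; rewrite /steps big_ord1 asboolT //= => /(_ s As).
case: (pselect (A `<=` B)) => [AB|nAB]; first by exists [::].
have [s As nBs] : exists2 s, A s & ~ B s.
  by apply: contrapT => hs; apply: nAB => s As; apply: contrapT => nBs; apply: hs;
    exists s.
have sB' : submod (msum B (line s)) by apply: submod_msum => //; exact: submod_line.
have BB' : B `<=` msum B (line s) by apply: sub_msuml; exact: submod_line.
have [||l [lA Al]] := ih _ sB'.
- by apply: msum_sub => // _ [r ->]; exact: submodZ.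
- move=> C k hC; pose C' i := if i is j.+1 then C j else B.
  have hC' : mchain C' B A.
    case=> [|i]; last by have [? b ? ?] := hC i; split=> //; exact: subset_trans b.
    by have [_ b _ _] := hC 0%N; split=> //; exact: subset_trans b.
  have := h _ k.+1 hC'; rewrite /steps big_ord_recl /= asboolT //.
  have [_ b _ _] := hC 0%N => /(_ s) hs; apply/nBs/hs/b.
  by apply: sub_msumr => //; exact: mem_line.
exists (rcons l s); split=> [t|].
  by rewrite mem_rcons inE => /orP[/eqP ->//|]; exact: lA.
by rewrite -cats1 /adj foldr_cat.
Qed.

End Adjoin.

(** * Length of S/xS for torsion-free S *)

Section TorsionFreeLength.
Variables (R : idomainType) (V : lmodType R).
Hypothesis V_tf : torsion_free V.
Implicit Types (A B F S : set V).

Lemma mchain_smul (x : R) (C : nat -> set V) B A : mchain C B A ->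
  mchain (fun i => smul x (C i)) (smul x B) (smul x A).
Proof.
move=> h k; have [sC BC CA CC] := h k; split; first exact: submod_smul.
all: by apply: image_subset.
Qed.

Lemma steps_smul (x : R) (C : nat -> set V) k : x != 0 ->
  steps (fun i => smul x (C i)) k = steps C k.
Proof.
move=> x0; have inj : injective ( *:%R x : V -> V).
  move=> u v /eqP; rewrite -subr_eq0 -scalerBr => /eqP/V_tf[/eqP|/eqP].
    by rewrite (negPf x0).
  by rewrite subr_eq0 => /eqP.
apply: eq_bigr => i _; congr (nat_of_bool `[< ~ _ >]); apply/propext; split.
  by move=> h v Cv; have [|w Cw /inj <-//] := h (x *: v); exists v.
by move=> h; apply: image_subset.
Qed.

Hypothesis finite_len : forall N : set R^o, submod N ->
  (exists2 r, N r & r != 0) -> exists n, len_le N setT n.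

(** For N/F of finite length, N/xF has length l(N/xN) + l(xN/xF) = l(N/F) + l(F/xF), and l(xN/xF) =
    l(N/F) since x acts injectively; thus l(N/xN) = l(F/xF). As S/F may have infinite length, this
    is applied to a submodule N that detects the given chain. *)
Lemma len_torsion_quotient (x : R) F S e : x != 0 -> submod F -> submod S ->
  F `<=` S -> (forall s, S s -> exists2 r, r != 0 & F (r *: s)) ->
  len_le (smul x F) F e -> len_le (smul x S) S e.
Proof.
move=> x0 sF sS FS tor lenF C k hC.
have /choice[c hc] : forall i, exists s, S s /\
    (~ C i.+1 `<=` C i -> C i.+1 s /\ ~ C i s).
  move=> i; case: (pselect (C i.+1 `<=` C i)) => [h|h]; first by exists 0;
    split=> //; exact: submod0 sS.
  suff [s Cs nCs] : exists2 s, C i.+1 s & ~ C i s.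
    by exists s; split=> //; have [_ _ + _] := hC i.+1; apply.
  by apply: contrapT => hs; apply: h => s Cs; apply: contrapT => nCs; apply: hs;
    exists s.
(* N contains a witness for each of the first k strict steps, so intersecting the chain with N loses
   none of them. *)
pose N := adj F (map c (iota 0 k)).
have sN : submod N by exact: submod_adj.
have FN : F `<=` N by exact: sub_adj.
have NS : N `<=` S.
  by apply: adj_sub => // _ /mapP[i _ ->]; have [] := hc i.
have [n lenN] : exists n, len_le F N n.
  have /choice[E hE] : forall s, exists n, S s -> len_le (colon F s) setT n.
    move=> s; case: (pselect (S s)) => [Ss|]; last by exists 0%N.
    have [|n hn] := finite_len (submod_colon s sF); last by exists n.
    by have [r r0 Fr] := tor s Ss; exists r.
  exists (\sum_(s <- map c (iota 0 k)) E s)%N; apply: len_adj => // _ /mapP[i _ ->].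
  by apply: hE; have [] := hc i.
have {lenN} [f [D [j [lenN hD stepD]]]] := len_exact sF FN lenN.
have xFxN : smul x F `<=` smul x N by apply: image_subset.
have hCN : mchain (fun i => C i `&` N) (smul x N) N.
  move=> i; have [sC BC _ CC] := hC i; split; first exact: submodI.
  - move=> v Nv; split; last exact: smul_sub Nv.
    by apply: BC; move: v Nv; apply: image_subset.
  - by move=> v [].
  - by move=> v [/CC].
(* A longest chain from F to N, multiplied by x, is continued by the traces of C on N. *)
have [G [hG]] := mchain_cat j k xFxN (smul_sub (r := x) sN) (mchain_smul x hD) hCN.
rewrite steps_smul // stepD => le1.
have lenT : len_le (smul x F) N (e + f).
  by apply: (len_leD sF) => //; exact: smul_sub.
rewrite -(leq_add2l f); apply: leq_trans (leq_trans le1 _); last first.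
  by rewrite [(f + e)%N]addnC; exact: lenT.
rewrite leq_add2l; apply: steps_le => i ik nC h.
have [_ /(_ nC)[C1 nC1]] := hc i; apply/nC1.
suff [] : (C i `&` N) (c i) by [].
apply: h; split=> //; apply: mem_adj => //; apply: map_f.
by rewrite mem_iota add0n ik.
Qed.

(** Modulo x F, where F is the span of b, each of the n generators is killed by x and so contributes
    at most l(R/xR). *)
Lemma len_span (x : R) n (b : 'I_n -> V) e : x != 0 ->
  len_le (line (x : R^o)) setT e ->
  len_le (smul x (mspan b)) (mspan b) (n * e).
Proof.
move=> x0 lenx; have sb := submod_span b.
have sxb := submod_smul x sb.
have := @len_adj _ _ (smul x (mspan b)) (map b (enum 'I_n)) (fun=> e) sxb.
rewrite big_const_seq count_predT size_map size_enum_ord iter_addn_0 mulnC.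
move=> h; apply: (len_le_sub (h _)) => //.
  move=> _ /mapP[i _ ->]; apply: (len_le_sub lenx) => // _ [r ->].
  rewrite /colon /= [r *: _]mulrC -scalerA; exists (r *: b i) => //.
  by apply: submodZ => //; exact: mem_span.
apply: span_sub; first exact: submod_adj.
by move=> i; apply: mem_adj => //; apply: map_f; rewrite mem_enum.
Qed.

End TorsionFreeLength.

(** * Dimension at most one *)

Section IdealPowers.
Variables (R : comNzRingType) (m : idealr R).

(** Multiplying X by d factors [m] keeps it inside N + aY with Y multiplied likewise; this is how
    powers of [m] are composed below. *)
Lemma iter_smul_sub (N X Y : set R^o) (a : R) d : submod N ->
  (forall r, X r -> exists n y, [/\ N n, Y y & r = n + a * y]) ->
  forall r, iter d (@ideal_smul R R^o m) X r ->
    exists n y, [/\ N n, iter d (@ideal_smul R R^o m) Y y & r = n + a * y].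
Proof.
move=> sN hX; elim: d => [|d ih] r; first exact: hX.
move=> [k [c [w [hw ->]]]].
have /choice[f /choice[g hfg]] : forall i, exists n y,
    [/\ N n, iter d (@ideal_smul R R^o m) Y y & w i = n + a * y].
  by move=> i; have [_ /ih] := hw i.
exists (\sum_i c i *: f i), (\sum_i c i *: g i); split.
- by apply: submod_sum => // i _; apply: submodZ => //; have [] := hfg i.
- by exists k, c, g; split=> // i; have [? _] := hw i; have [] := hfg i.
- rewrite mulr_sumr -big_split; apply: eq_bigr => i _ /=.
  have [_ _ ->] := hfg i; rewrite scalerDr; congr (_ + _).
  by rewrite /GRing.scale /= mulrCA.
Qed.

Lemma ideal_exp_pow x k r : x \in m -> ideal_exp m k (x ^+ k * r).
Proof.
move=> xm; elim: k => [//|k ih].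
exists 1%N, (fun=> x), (fun=> x ^+ k * r); split=> //.
by rewrite big_ord1 exprS -mulrA.
Qed.

Lemma ideal_exp1 r : ideal_exp m 1 r -> r \in m.
Proof.
move=> [k [a [w [aw ->]]]]; apply: rpred_sum => i _.
by rewrite /GRing.scale /= mulrC; apply: ring_quotient.idealMr; have [] := aw i.
Qed.

End IdealPowers.

Section DimOne.
Variables (R : idomainType) (m : idealr R).
Hypotheses (R_noetherian : noetherian R) (R_local : local_with m).
Hypothesis R_dim : krull_dim_le R 1.

Let nz (N : set R^o) := exists2 r, N r & r != 0.

Lemma nonzero_prime (P : set R^o) : prime_set P -> nz P -> forall y, y \in m -> P y.
Proof.
by move=> pP [x Px x0] y; move/(dim_le1P R_noetherian R_local): R_dim; apply;
  eassumption.
Qed.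

Lemma nz_sub (M N : set R^o) : M `<=` N -> nz M -> nz N.
Proof. by move=> MN [r /MN Nr r0]; exists r. Qed.

(** A strict step above [m] brings in a unit, and no strict step can follow; hence the count is
    bounded by whether 1 has been reached. *)
Lemma len_max : len_le [set x : R^o | x \in m] setT 1.
Proof.
move=> C k hC; suff : (steps C k <= `[< C k 1%R >])%N by move/leq_trans; apply;
  case: asboolP.
elim: k => [|k ih]; first by rewrite /steps big_ord0.
rewrite /steps big_ord_recr /= -/(steps C k).
have [sC mC _ CC] := hC k; have [sC' _ _ _] := hC k.+1.
case: (asboolP (~ C k.+1 `<=` C k)) => [nC|_]; last first.
  by rewrite addn0; apply: (leq_trans ih); case: asboolP => // /CC h; rewrite asboolT.
have [r Cr nCr] : exists2 r, C k.+1 r & ~ C k r.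
  by apply: contrapT => h; apply: nC => r Cr; apply: contrapT => nCr; apply: h;
    exists r.
have rm : r \notin m by apply/negP => rm; exact/nCr/mC.
have [s sr] := local_inv R_noetherian R_local rm.
have C1 : C k.+1 1 by rewrite -sr; exact: idealM.
rewrite (asboolT C1) addn1 ltnS; apply: (leq_trans ih).
by case: asboolP => // /(ideal1 sC) h; case: nCr; rewrite h.
Qed.

(** A nonzero prime contains [m]; otherwise the lengths of R/(N:a) and R/(N + aR) add up. *)
Lemma finite_len N : submod N -> nz N -> exists n, len_le N setT n.
Proof.
move: N; apply: (prime_ind R_noetherian) => [_|P pP nzP|N a sN ih1 ih2 nzN].
- exists 0%N => C k hC; rewrite /steps big1 // => i _; apply/eqP; rewrite eqb0.
  by apply/asboolPn => h; apply: h => v _; have [_ h _ _] := hC i; exact: h.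
- exists 1%N; apply: (len_le_sub len_max) => // y; exact: nonzero_prime.
- have sl := submod_line a; have NNa : N `<=` msum N (line a) by exact: sub_msuml.
  have [n1 h1] := ih1 (nz_sub NNa nzN).
  have [|n2 h2] := ih2; first by apply: nz_sub nzN => r Nr; exact: idealMr.
  exists (n2 + n1)%N; apply: (len_leD (submod_msum sN sl) NNa) => //.
  exact: len_line h2.
Qed.

(** From m^c in N + aR and m^d in (N:a) follows that m^(d+c) lies in N + a m^d, which is inside
    N. *)
Lemma max_power_sub N : submod N -> nz N -> exists c, ideal_exp m c `<=` N.
Proof.
move: N; apply: (prime_ind R_noetherian) => [_|P pP nzP|N a sN ih1 ih2 nzN].
- by exists 0%N.
- by exists 1%N => r /ideal_exp1; exact: nonzero_prime.
- have [|c hc] := ih1; first by apply: nz_sub nzN; apply: sub_msuml; exact: submod_line.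
  have [|d hd] := ih2; first by apply: nz_sub nzN => r Nr; exact: idealMr.
  exists (d + c)%N; rewrite /ideal_exp iterD => r.
  move=> /(iter_smul_sub (N := N) (Y := setT) (a := a) sN)[|n [y [Nn /hd Ny ->]]].
    by move=> _ /hc[n [_ [Nn [y ->] ->]]]; exists n, y; split=> //; rewrite mulrC.
  by apply: (@submodD _ R^o) => //; rewrite mulrC.
Qed.

Variable x : R.
Hypotheses (x0 : x != 0) (xm : x \in m).

(** Otherwise some prime contains r and avoids all powers of x, although a nonzero prime contains
    [m]. *)
Lemma dvd_pow r : r != 0 -> exists N s, x ^+ N = s * r.
Proof.
move=> r0; apply: contrapT => h.
pose M := [set y | exists k, y = x ^+ k].
have [||y [k ->] [s /= e]|P [pP rP MP]] :=
    @prime_avoiding _ R_noetherian (line (r : R^o)) M (submod_line _).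
- by exists 0%N.
- by move=> _ _ [j ->] [k ->]; exists (j + k)%N; rewrite exprD.
- by apply: h; exists k, s.
apply: (MP x); first by exists 1%N.
by apply: (nonzero_prime pP) => //; exists r => //; apply: rP; exact: mem_line.
Qed.

Hypothesis R_complete : adically_complete m.

(** Completeness passes from the m-adic to the x-adic topology: x^k lies in m^k, and m^c inside xR
    gives m^(ck) inside x^k R. *)
Lemma pow_complete (u : nat -> R) :
  (forall k, exists w, u k.+1 - u k = x ^+ k * w) ->
  exists l, forall k, exists w, u k - l = x ^+ k * w.
Proof.
move=> hu; have hu' k j : exists w, u (k + j)%N - u k = x ^+ k * w.
  elim: j => [|j [w hw]]; first by exists 0; rewrite addn0 subrr mulr0.
  have [w' hw'] := hu (k + j)%N; exists (x ^+ j * w' + w).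
  by rewrite mulrDr mulrA -exprD -hw' -hw addnS addrA subrK.
have hu2 k i : (k <= i)%N -> exists w, u i - u k = x ^+ k * w.
  by move=> /subnKC <-; exact: hu'.
have [|l [hl _]] := R_complete (u := u).
  move=> n; exists n => i j /hu2[w hw] /hu2[w' hw'].
  rewrite (_ : _ - _ = x ^+ n * (w - w')); first exact: ideal_exp_pow.
  by rewrite mulrBr -hw -hw' opprB addrA subrK.
exists l => k.
have [|c hc] := max_power_sub (submod_line (x : R^o)); first by exists x => //;
  exact: mem_line.
have hck r : ideal_exp m (c * k) r -> exists w, r = x ^+ k * w.
  elim: k r {hu hu' hu2 hl} => [|k ih] r; first by exists r; rewrite expr0 mul1r.
  rewrite mulnS /ideal_exp iterD.
  move=> /(iter_smul_sub (N := [set 0]) (Y := setT) (a :=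
    x ^+ k) (@submod_set0 _ R^o))[|_ [y [/= -> /hc[w ->] ->]]].
    by move=> t /ih[w ->]; exists 0, w; split=> //; rewrite add0r.
  by exists w; rewrite add0r exprSr -mulrA [_ *: _]mulrC.
have [N hN] := hl (c * k)%N.
have [w hw] := hck _ (hN (N + k)%N (leq_addr _ _)).
have [w' hw'] := hu2 k (N + k)%N (leq_addl _ _).
by exists (w - w'); rewrite mulrBr -hw -hw' opprB [RHS]addrC addrA subrK.
Qed.

(** Finite length of S/xS gives S = M + xS with M spanned by l. Iterating this expands the
    coefficients of s in powers of x, and completeness sums the expansions. *)
Lemma reduced_fg (V : lmodType R) (S : set V) n (b : 'I_n -> V) :
  torsion_free V -> submod S -> (forall i, S (b i)) ->
  (forall s, S s -> exists2 r, r != 0 & mspan b (r *: s)) ->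
  exists l, (forall s, s \in l -> S s) /\
    forall s, S s -> exists a : nat -> R, forall k, exists2 w, S w &
      s - \sum_(i < size l) a i *: l`_i = x ^+ k *: w.
Proof.
move=> V_tf sS Sb tor.
have sb := submod_span b; have bS : mspan b `<=` S by exact: span_sub.
have [|e he] := finite_len (submod_line (x : R^o)); first by exists x => //;
  exact: mem_line.
have lenS := len_torsion_quotient V_tf finite_len x0 sb sS bS tor (len_span (b :=
  b) x0 he).
have [l [lS Sl]] := len_fg (submod_smul x sS) sS (smul_sub (r := x) sS) lenS.
exists l; split=> // s Ss.
(* [F] splits s as x times its first component plus a combination of l; the values outside S are
   dummies. *)
have /choice[F hF] : forall s, exists p : V * (nat -> R), S s ->
    S p.1 /\ s = x *: p.1 + \sum_(i < size l) p.2 i *: l`_i.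
  move=> {Ss} {}s; case: (pselect (S s)) => [Ss|]; last by exists (0, fun=> 0).
  have [_ [v [[w Sw <-] /adj0_sum[a ->] sw]]] := adj_msum (submod_smul x sS) (Sl s Ss).
  by exists (w, a).
pose t k := iter k (fun v => (F v).1) s.
have St k : S (t k) by elim: k => //= k /hF[].
(* Partial sums of the expansion of the i-th coefficient; [t k] is the remainder after k divisions
   by x. *)
pose u k i := \sum_(j < k) x ^+ j * (F (t j)).2 i.
have hs k : s = x ^+ k *: t k + \sum_(i < size l) u k i *: l`_i.
  elim: k => [|k ih].
    by rewrite expr0 scale1r big1 ?addr0 // => i _; rewrite /u big_ord0 scale0r.
  rewrite {1}ih {1}(hF _ (St k)).2 scalerDr scalerA -exprSr -addrA; congr (_ + _).
  rewrite scaler_sumr -big_split; apply: eq_bigr => i _ /=.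
  by rewrite scalerA -scalerDl /u big_ord_recr /= addrC.
have /choice[L hL] : forall i, exists l, forall k, exists w, u k i - l = x ^+ k * w.
  move=> i; apply: (pow_complete (u := fun k => u k i)) => k.
  by exists ((F (t k)).2 i); rewrite /u big_ord_recr /= addrAC subrr add0r.
exists L => k; have /choice[w hw] : forall i, exists w, u k i - L i = x ^+ k * w.
  by move=> i.
exists (t k + \sum_(i < size l) w i *: l`_i).
  by apply: submodD => //; apply: submod_sum => // i _; apply: submodZ => //;
    apply: lS; exact: mem_nth.
rewrite [in LHS](hs k) -addrA scalerDr; congr (_ + _).
rewrite -sumrB scaler_sumr; apply: eq_bigr => i _.
by rewrite -scalerBl hw scalerA.
Qed.

End DimOne.

Section Structure.
Variables (R : idomainType) (m : idealr R).
Hypotheses (R_noetherian : noetherian R) (R_local : local_with m).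
Hypotheses (R_dim : krull_dim_le R 1) (R_complete : adically_complete m).

(** D is the intersection of the x^k S; it is divisible because every nonzero r divides a power of
    x. If [m] is zero, R is a field, b already spans S, and D = 0. *)
Lemma fg_plus_divisible (V : lmodType R) (S : set V) n (b : 'I_n -> V) :
  torsion_free V -> submod S -> (forall i, S (b i)) ->
  (forall s, S s -> exists2 r, r != 0 & mspan b (r *: s)) ->
  exists l D, [/\ forall s, s \in l -> S s, submod D, D `<=` S,
    forall (r : R) d, r != 0 -> D d -> exists2 d', D d' & d = r *: d' &
    forall s, S s -> exists a : nat -> R, D (s - \sum_(i < size l) a i *: l`_i)].
Proof.
move=> V_tf sS Sb tor; case: (pselect (exists x, x != 0 /\ x \in m))
  => [[x [x0 xm]]|hf].
  have [l [lS hl]] := reduced_fg R_noetherian R_local R_dim x0 xm R_complete V_tf sS Sb tor.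
  exists l, [set v | forall k, exists2 w, S w & v = x ^+ k *: w]; split=> //.
  - split; first by move=> k; exists 0; [exact: submod0 sS | rewrite scaler0].
    move=> a u v hu hv k; have [w Sw ->] := hu k; have [w' Sw' ->] := hv k.
    exists (a *: w + w'); first by case: sS => _; apply.
    by rewrite scalerDr !scalerA mulrC.
  - by move=> v /(_ 0%N)[w Sw ->]; apply: submodZ.
  - move=> r d r0 Dd; have [N [s e]] := dvd_pow R_noetherian R_local R_dim xm r0.
    have [w Sw dw] := Dd N; exists (s *: w); last by rewrite scalerA mulrC -e.
    move=> k; have [v Sv dv] := Dd (N + k)%N; exists (s *: v); first exact: submodZ.
    rewrite scalerA mulrC -scalerA; congr (_ *: _).
    have : x ^+ N *: (w - x ^+ k *: v) = 0.
      by rewrite scalerBr scalerA -exprD -dv -dw subrr.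
    by move=> /V_tf[/eqP|/eqP]; rewrite ?expf_eq0 ?(negPf x0) ?andbF // subr_eq0 => /eqP.
exists (map b (enum 'I_n)), [set 0]; split=> //.
- by move=> _ /mapP[i _ ->].
- exact: submod_set0.
- by move=> v ->; exact: submod0 sS.
- by move=> r d _ ->; exists 0; rewrite ?scaler0.
move=> s Ss; have [r r0 br] := tor s Ss.
have rm : r \notin m by apply/negP => rm; apply: hf; exists r.
have [t tr] := local_inv R_noetherian R_local rm.
have : mspan b s by rewrite -[s]scale1r -tr -scalerA; apply: submodZ => //;
  exact: submod_span.
have : mspan b `<=` adj [set 0] (map b (enum 'I_n)).
  have s0 := @submod_set0 _ V; apply: span_sub; first exact: submod_adj.
  by move=> i; apply: mem_adj => //; apply: map_f; rewrite mem_enum.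
by move=> h /h/adj0_sum[a ->]; exists a; rewrite subrr.
Qed.

End Structure.

Lemma common_denom (R : idomainType) n (v : 'I_n -> {fraction R}) :
  exists2 d : R, d != 0 & forall i, exists a, d%:F * v i = a%:F.
Proof.
have /choice[b hb] : forall i, exists b : R, b != 0 /\ exists a, b%:F * v i = a%:F.
  move=> i; have [a [b [b0 ->]]] := fracP (v i); exists b; split=> //; exists a.
  by rewrite mulrCA mulfV ?mulr1 ?tofrac_neq0.
exists (\prod_i b i); first by apply/prodf_neq0 => i _; have [] := hb i.
move=> i; have [_ [a ha]] := hb i; exists ((\prod_(j | j != i) b j) * a).
by rewrite (bigD1 i) //= !tofracM -ha mulrAC mulrC mulrA.
Qed.

(** A matrix of largest rank with row space inside D fills D. *)
Lemma subspace_mx (F : fieldType) n (D : set 'rV[F]_n) : submod D ->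
  exists A : 'M[F]_n, forall v, (v <= A)%MS <-> D v.
Proof.
move=> sD; pose T r := `[< exists A : 'M[F]_n, \rank A = r /\ forall v, (v <= A)%MS -> D v >].
have T0 : exists r, T r.
  exists 0%N; apply/asboolP; exists 0; rewrite mxrank0; split=> // v.
  by rewrite submx0 => /eqP ->; exact: submod0 sD.
have Tn r : T r -> (r <= n)%N by move=> /asboolP[A [<- _]]; exact: rank_leq_row.
case: (ex_maxnP T0 Tn) => _ /asboolP[A [<- AD]] Amax.
exists A => v; split=> [|Dv]; first exact: AD.
apply: contrapT => /negP nA; have lt : (A < A + v)%MS.
  by rewrite ltmxE addsmxSl /=; apply: contra nA; apply: submx_trans; exact: addsmxSr.
suff /Amax : T (\rank (A + v)%MS) by rewrite leqNgt rank_ltmx.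
apply/asboolP; exists (A + v)%MS; split=> // w /sub_addsmxP[[u1 u2] /= ->].
apply: submodD => //; first by apply/AD; exact: submxMl.
by rewrite [u2]mx11_scalar mul_scalar_mx; apply: submodZ.
Qed.

(** * Splitting off the divisible part *)

Section Decomposition.
Variables (R : idomainType) (m : idealr R).
Hypotheses (R_noetherian : noetherian R) (R_local : local_with m).
Hypotheses (R_dim : krull_dim_le R 1) (R_complete : adically_complete m).
Local Notation Q := {fraction R}.

(** Divisibility makes the image of D in Q^n a Q-subspace. A linear retraction onto it restricts to
    S and splits D off; the complement is finitely generated as the image of S = M + D under a map
    killing D. *)
Lemma torsion_free_decomposition (S : lmodType R) :
  torsion_free S -> finite_rank S ->
  exists t (M : lmodType R), fin_gen M /\ lmod_iso S ({ffun 'I_t -> Q} * M)%type.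
Proof.
move=> S_tf /(finite_rank_embedding S_tf)[n [c [c_lin c_inj c_span]]].
have cD u v : c (u + v) = c u + c v by rewrite -[u]scale1r c_lin tofrac1 !scale1r.
have c0 : c 0 = 0.
  by apply: (addrI (c 0)); rewrite -cD !addr0.
have cZ a u : c (a *: u) = a%:F *: c u by rewrite -[_ *: u]addr0 c_lin c0 addr0.
have cB u v : c (u - v) = c u - c v by rewrite -scaleN1r cD cZ tofracN tofrac1 scaleN1r.
have cS I (r : seq I) (F : I -> S) : c (\sum_(i <- r) F i) = \sum_(i <- r) c (F i).
  by apply: (big_morph c cD c0).
have /choice[d /choice[b hb]] : forall j,
  exists (d : R) s, d != 0 /\ d%:F *: delta_mx 0 j = c s.
  by move=> j; exact: c_span.
have tor s : setT s -> exists2 r, r != 0 & mspan b (r *: s).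
  move=> _; have [r r0 /choice[a ha]] := common_denom (fun j => c s 0 j / (d j)%:F).
  exists r => //; exists a; apply: c_inj; rewrite cZ cS.
  apply/rowP => j; rewrite mxE summxE (bigD1 j) //= big1 => [|k kj].
    rewrite addr0 cZ -(hb j).2 -ha !mxE !eqxx mulr1 -mulrA mulfVK //.
    by rewrite tofrac_neq0 //; have [] := hb j.
  by rewrite cZ -(hb k).2 !mxE /= (negPf (_ : j != k)) ?mulr0 // eq_sym.
have [l [D [_ sD _ Ddiv Sl]]] := fg_plus_divisible R_noetherian R_local R_dim
  R_complete S_tf (@submodT _ S) (fun=> I) tor.
have sDQ : submod (c @` D : set 'rV[Q]_n).
  split; first by exists 0 => //; exact: submod0 sD.
  move=> q _ _ [u Du <-] [v Dv <-]; have [a [e [e0 ->]]] := fracP q.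
  have [w Dw ->] := Ddiv _ _ e0 Du; exists (a *: w + v); first by case: sD => _; apply.
  by rewrite cD !cZ scalerA mulfVK ?tofrac_neq0.
have [A hA] := subspace_mx sDQ.
pose B := row_base A; have Bfree : row_free B by exact: row_base_free.
have hB v : (v <= B)%MS <-> (c @` D) v by rewrite (eq_row_base A).
have /choice[io hio] : forall u, exists s, D s /\ c s = u *m B.
  by move=> u; have /hB[s Ds e] := submxMl u B; exists s.
(* The pseudo-inverse of a basis B retracts all of Q^n onto the coordinates of its row space; [io]
   turns such coordinates back into elements of D. *)
pose p s := c s *m pinvmx B.
have p_lin a u v : p (a *: u + v) = a%:F *: p u + p v.
  by rewrite /p c_lin mulmxDl scalemxAl.
have pio u : p (io u) = u by rewrite /p (hio u).2 mulmxKp.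
have iop s : D s -> io (p s) = s.
  by move=> Ds; apply: c_inj; rewrite (hio _).2 mulmxKpV //; apply/hB; exists s.
have io_lin a u v : io (a%:F *: u + v) = a *: io u + io v.
  by apply: c_inj; rewrite (hio _).2 cD cZ !(hio _).2 mulmxDl scalemxAl.
have sK : submod [set s | p s = 0].
  split; first by rewrite /= /p c0 mul0mx.
  by move=> a u v /= pu pv; rewrite p_lin pu pv scaler0 addr0.
have k_lin : linear (fun s => s - io (p s)).
  by move=> a u v; rewrite p_lin io_lin scalerBr opprD addrACA.
pose k := lin k_lin; have kE s : k s = s - io (p s) by [].
have pk s : [set s | p s = 0] (k s).
  by rewrite kE /= /p cB mulmxBl -!/(p _) pio subrr.
have io0 : io 0 = 0.
  have /esym/eqP := io_lin 1 0 0; rewrite scaler0 addr0 scale1r.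
  by rewrite -subr_eq0 addrK => /eqP.
have kD s : D s -> k s = 0 by move=> Ds; rewrite kE iop // subrr.
have k_id s : p s = 0 -> k s = s by move=> ps; rewrite kE ps io0 subr0.
exists (\rank A), (subm sK); split.
  exists (size l), (fun i => insubm (pk l`_i)) => x.
  have [a Da] := Sl (val x) Logic.I; exists (fun i => a i); apply: subm_eq.
  have := kD _ Da; rewrite linearB (k_id _ (submP x)) => /eqP;
    rewrite subr_eq0 => /eqP ->.
  rewrite !raddf_sum; apply: eq_bigr => i _; exact: linearZ.
pose f s : {ffun 'I_(\rank A) -> Q} * subm sK := ([ffun i => p s 0 i], insubm (pk s)).
have f_lin : linear f.
  move=> a u v; rewrite /f; congr pair.
    by apply/ffunP => i; rewrite !ffunE p_lin !mxE.
  by apply: subm_eq; rewrite /= k_lin.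
exists (lin f_lin); exists (fun z : {ffun 'I_(\rank A) ->
  Q} * subm sK => io (\row_i z.1 i) + val z.2) => [s|[h z]] /=.
  rewrite (_ : \row_i _ = p s); first by rewrite addrC subrK.
  by apply/rowP => i; rewrite mxE ffunE.
have e : p (io (\row_i h i) + val z) = \row_i h i.
  by rewrite -[io _]scale1r p_lin tofrac1 scale1r pio (submP z) addr0.
rewrite /f; congr pair; first by apply/ffunP => i; rewrite ffunE e mxE.
by apply: subm_eq; rewrite /= e addrAC subrr add0r.
Qed.

End Decomposition.

(** * Matlis reflexivity *)

Lemma pair_linear (R : pzRingType) (U V : lmodType R) a (u u' : U) (v v' : V) :
  a *: (u, v) + (u', v') = (a *: u + u', a *: v + v').
Proof. by []. Qed.

Section Reflexive.
Variables (R : comNzRingType) (E : lmodType R).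
Implicit Types (S U V : lmodType R).

Definition hom_of U V (f : U -> V) (fl : linear f) : hom U V := Hom (asboolT fl).

Lemma hom_eq U V (f g : hom U V) : f =1 g -> f = g.
Proof. by move=> fg; apply: val_inj; apply: funext. Qed.

Definition hom_lin U V (f : hom U V) : {linear U -> V} := lin (hom_linear f).

Lemma homD U V (f : hom U V) u v : f (u + v) = f u + f v.
Proof. exact: (linearD (hom_lin f)). Qed.

Lemma homZ U V (f : hom U V) a u : f (a *: u) = a *: f u.
Proof. exact: (linearZ_LR (hom_lin f)). Qed.

Fact hom_comp_linear U V (p : {linear U ->
  V}) (f : hom V E) : linear (fun u => f (p u)).
Proof. by move=> a u v; rewrite linearP hom_linear. Qed.

Definition hom_comp U V (p : {linear U -> V}) (f : hom V E) : hom U E :=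
  hom_of (hom_comp_linear p f).

Lemma hom_comp_is_linear U V (p : {linear U -> V}) : linear (hom_comp p).
Proof. by move=> a f g; apply: hom_eq. Qed.

(** Only the surjective half of reflexivity, because it passes to quotients; the injective half
    holds for every S, as E is a cogenerator ([eval_surj_reflexive]). *)
Definition eval_surj S := forall xi : hom (hom S E) E, exists s, forall f, xi f = f s.

Hypothesis E_injective : injective_module E.

(** Since U + V maps onto S, Hom(S, E) embeds in Hom(U, E) x Hom(V, E). As E is injective, xi
    extends to the product, where it is evaluation at a pair. *)
Lemma eval_surj_sum U V S (p : {linear U -> S}) (q : {linear V -> S}) :
  eval_surj U -> eval_surj V -> (forall s, exists u v, s = p u + q v) -> eval_surj S.
Proof.
move=> sU sV pq xi.
have jl : linear (fun f : hom S E => (hom_comp p f, hom_comp q f)).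
  by move=> a f g; congr pair; apply: hom_eq.
have [|g hg] := E_injective (i := lin jl) (hom_lin xi).
  move=> f f' /= [e1 e2]; apply: hom_eq => s; have [u [v ->]] := pq s.
  by rewrite !homD; congr (_ + _);
    [exact: (congr1 (fun h => h u) e1) | exact: (congr1 (fun h => h v) e2)].
have gl1 : linear (fun h : hom U E => g (h, 0)).
  by move=> a h h'; rewrite -linearP pair_linear scaler0 addr0.
have gl2 : linear (fun h : hom V E => g (0, h)).
  by move=> a h h'; rewrite -linearP pair_linear scaler0 addr0.
have [u hu] := sU (hom_of gl1); have [v hv] := sV (hom_of gl2).
exists (p u + q v) => f.
rewrite homD -[f (p u)]/(hom_comp p f u) -[f (q v)]/(hom_comp q f v) -hu -hv /=.
rewrite -linearD /= -[LHS]/(hom_lin xi f) -hg /=; congr (g _).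
by congr pair; rewrite ?addr0 ?add0r.
Qed.

Lemma eval_surj_quot U S (p : {linear U -> S}) :
  eval_surj U -> (forall s, exists u, s = p u) -> eval_surj S.
Proof.
move=> sU hp; apply: (eval_surj_sum (p := p) (q := p) sU sU) => s.
by have [u ->] := hp s; exists u, 0; rewrite linear0 addr0.
Qed.

Lemma eval_surj_prod U V : eval_surj U -> eval_surj V -> eval_surj (U * V)%type.
Proof.
have l1 : linear (fun u : U => (u, 0 : V)) by move=> a u v;
  rewrite pair_linear scaler0 addr0.
have l2 : linear (fun v : V => (0 : U, v)) by move=> a u v;
  rewrite pair_linear scaler0 addr0.
move=> sU sV; apply: (eval_surj_sum (p := lin l1) (q := lin l2) sU sV) => -[u v].
by exists u, v; congr pair; rewrite ?addr0 ?add0r.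
Qed.

Lemma eval_surj_ffun U n : eval_surj U -> eval_surj {ffun 'I_n -> U}.
Proof.
move=> sU xi.
have pl j : linear (fun h : {ffun 'I_n -> U} => h j) by move=> a u v; rewrite !ffunE.
have il j : linear (fun u : U => [ffun i => if i == j then u else 0] : {ffun 'I_n ->
  U}).
  by move=> a u v; apply/ffunP => i; rewrite !ffunE; case: eqP => // _;
    rewrite scaler0 addr0.
have xl j : linear (fun h : hom U E => xi (hom_comp (lin (pl j)) h)).
  by move=> a h h'; rewrite hom_comp_is_linear hom_linear.
have /choice[s hs] : forall j, exists s, forall h, xi (hom_comp (lin (pl j)) h) = h s.
  by move=> j; have [s hs] := sU (hom_of (xl j)); exists s.
exists [ffun j => s j] => f.
have fsum (h : {ffun 'I_n -> U}) : f h = \sum_j hom_comp (lin (il j)) f (h j).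
  rewrite -[f h]/(hom_lin f h) {1}(_ : h = \sum_j lin (il j) (h j)).
    by rewrite linear_sum.
  apply/ffunP => i; rewrite sum_ffunE (bigD1 i) //= ffunE eqxx big1 ?addr0 // => j ji.
  by rewrite ffunE eq_sym (negPf ji).
rewrite fsum.
have {1}-> : f = \sum_j hom_comp (lin (pl j)) (hom_comp (lin (il j)) f).
  apply: hom_eq => h; rewrite fsum.
  by elim/big_rec2: _ => // j y g _ ->.
rewrite -[LHS]/(hom_lin xi _) linear_sum; apply: eq_bigr => j _.
by rewrite /= hs ffunE.
Qed.

End Reflexive.

Section Matlis.
Variables (R : idomainType) (m : idealr R).
Hypotheses (R_noetherian : noetherian R) (R_local : local_with m).
Variables (E : lmodType R) (i : {linear {ideal_quot m} -> E}).
Hypothesis E_envelope : is_injective_envelope i.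
Local Notation Q := {fraction R}.

Let E_injective : injective_module E. Proof. by case: E_envelope. Qed.

Lemma eval_surj_reflexive (S : lmodType R) : eval_surj E S -> matlis_reflexive E S.
Proof.
move=> surj; have inj : injective (@evaluation R E S).
  move=> u v e; apply: contrapT => uv.
  have [|f [_]] := cogenerator R_noetherian R_local E_envelope (z := u - v)
    (@submod_set0 _ S).
    by move=> /= /eqP; rewrite subr_eq0 => /eqP.
  rewrite linearB subr_eq0 => /eqP; apply.
  exact: (congr1 (fun xi : hom _ _ => xi (hom_of (linearP f))) e).
have /choice[g hg] : forall xi : hom (hom S E) E, exists s, evaluation E s = xi.
  by move=> xi; have [s hs] := surj xi; exists s; apply: hom_eq => f; rewrite hs.
by exists g => [s|//]; apply: inj; rewrite hg.
Qed.

Lemma essential_line (e : E) : (forall v r, i v = r *: e -> v = 0) -> e = 0.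
Proof.
move=> h; have [_ _ ess] := E_envelope.
have cl : submod_closed (fun y => `[< line e y >]).
  have [l0 hl] := submod_line e.
  by split=> [|a u v /asboolP Au /asboolP Av]; apply/asboolP; [exact: l0 | exact: hl].
by apply: (ess _ cl) => [v /asboolP[r /h]//|]; apply/asboolP; exact: mem_line.
Qed.

(** If e were outside the image of [i], Re would meet that image trivially: elements of [m] kill e,
    and units would carry e into the image. Essentiality excludes this unless e = 0. *)
Lemma socle (e : E) : (forall r, r \in m -> r *: e = 0) -> exists v, e = i v.
Proof.
move=> me; apply: contrapT => h; case: (h); exists 0; rewrite linear0.
apply: essential_line => v r ire; have [_ inji _] := E_envelope.
have [rm|/(local_inv R_noetherian R_local)[s sr]] := boolP (r \in m).
  by apply: inji; rewrite ire me // linear0.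
by case: h; exists (s *: v); rewrite linearZ /= ire scalerA sr scale1r.
Qed.

(** If a is not in N, some map R -> E kills N but not a; its value at 1 is a counterexample. *)
Lemma annihilator_sub (N : set R^o) a : submod N ->
  (forall e : E, (forall n, N n -> n *: e = 0) -> a *: e = 0) -> N a.
Proof.
move=> sN h; apply: contrapT => nNa.
have [f [fN]] := cogenerator R_noetherian R_local E_envelope sN nNa.
have fE r : f r = r *: f 1 by rewrite -linearZ /= [_ *: _]mulr1.
by rewrite fE h ?eqxx // => n /fN; rewrite fE.
Qed.

Let scalar_on (N : set R^o) := forall f : {linear E -> E}, exists r : R,
  forall e, (forall n, N n -> n *: e = 0) -> f e = r *: e.

Lemma endo_socle : scalar_on [set x | x \in m].
Proof.
move=> f; have [|v0 hv0] := @socle (f (i 1)).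
  move=> r rm; rewrite -!linearZ /= (_ : r *: (1 : {ideal_quot m}) = 0) ?linear0 //.
  by rewrite pi_scale; apply/eqP; rewrite mulr1 pi_eq0.
exists (repr v0) => e /socle[x ->].
have iE y : i y = repr y *: i 1 by rewrite -linearZ /= pi_scale mulr1 reprK.
by rewrite [i x]iE linearZ /= hv0 iE !scalerA mulrC.
Qed.

(** Let f be r on what N + aR kills. For e killed by N, f(e) - r e depends only on a e, which (N:a)
    kills; this dependence extends to an endomorphism of E, which acts there as a scalar s. So f(e)
    = (r + s a) e. *)
Lemma endo_scalar_step (N : set R^o) (a : R^o) : submod N ->
  scalar_on (msum N (line a)) -> scalar_on (colon N a) -> scalar_on N.
Proof.
move=> sN ih1 ih2 f; have [r hr] := ih1 f.
pose kill (e : E) := forall n, N n -> n *: e = 0.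
pose G : set (E * E)%type := [set p | exists e, kill e /\ p = (a *: e, f e - r *: e)].
have [||g hg] := injective_graph (G := G) E_injective.
- split.
    by exists 0; split=> [n _|]; [rewrite scaler0 | rewrite (linear0 f) !scaler0 subr0].
  move=> b _ _ [u [ku ->]] [v [kv ->]]; exists (b *: u + v); split.
    by move=> n Nn; rewrite scalerDr scalerA mulrC -scalerA ku // kv // scaler0 addr0.
  rewrite -[LHS]/(b *: (a *: u) + a *: v, b *: (f u - r *: u) + (f v - r *: v)).
  congr pair; first by rewrite scalerDr !scalerA mulrC.
  by rewrite linearP [r *: (_ + _)]scalerDr [b *: (_ - _)]scalerBr !scalerA [r * b]mulrC opprD addrACA.
- move=> e [u [ku [au ->]]]; apply/eqP; rewrite subr_eq0; apply/eqP/hr.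
  move=> n [n' [_ [Nn' [t ->] ->]]].
  by rewrite scalerDl ku // -scalerA -au scaler0 addr0.
have [s hs] := ih2 g; exists (r + s * a) => e ke.
have /hg : G (a *: e, f e - r *: e) by exists e.
rewrite hs => [|n Nn]; last by rewrite scalerA; apply: ke.
by move/eqP; rewrite eq_sym subr_eq => /eqP ->; rewrite scalerA scalerDl addrC.
Qed.

Hypotheses (R_dim : krull_dim_le R 1) (R_complete : adically_complete m).

Lemma endo_scalar_ideal (N : set R^o) : submod N -> (exists2 r, N r & r != 0) ->
  scalar_on N.
Proof.
move: N; apply: (prime_ind R_noetherian) => [_ f|P pP nzP f|N a sN ih1 ih2 nzN].
- by exists 0 => e /(_ 1 Logic.I); rewrite scale1r => ->; rewrite linear0 scaler0.
- have [r hr] := endo_socle f; exists r => e ke; apply: hr => n nm.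
  by apply: ke; exact: (nonzero_prime R_noetherian R_local R_dim pP nzP).
- apply: (endo_scalar_step sN).
    by apply: ih1; apply: nz_sub nzN; apply: sub_msuml; exact: submod_line.
  by apply: ih2; apply: nz_sub nzN => r Nr; exact: idealMr.
Qed.

(** If no nonzero scalar kills e, then i(v) = r e forces x r e = i(x v) = 0 and r = 0, so that e = 0
    by essentiality. Otherwise [dvd_pow] applies. *)
Lemma envelope_torsion x (e : E) : x != 0 -> x \in m -> exists k, x ^+ k *: e = 0.
Proof.
move=> x0 xm.
case: (pselect (exists2 r, r != 0 & r *: e = 0)) => [[r r0 re]|h].
  have [k [s xk]] := dvd_pow R_noetherian R_local R_dim xm r0.
  by exists k; rewrite xk -scalerA re scaler0.
exists 0%N; rewrite expr0 scale1r; apply: essential_line => v r ire.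
have [r0|r0] := eqVneq r 0.
  by have [_ inji _] := E_envelope; apply: inji; rewrite ire r0 scale0r linear0.
case: h; exists (x * r); first exact: mulf_neq0.
rewrite -scalerA -ire -linearZ /= (_ : x *: v = 0) ?linear0 //.
by rewrite pi_scale (eqP (_ : \pi x == 0)) ?mul0r // pi_eq0.
Qed.

(** On the elements killed by x^k, f is a scalar a_k. By [annihilator_sub] these scalars are
    x-adically Cauchy, and their limit works on all of E. *)
Lemma endo_scalar (f : {linear E -> E}) : exists r, forall e, f e = r *: e.
Proof.
case: (pselect (exists x, x != 0 /\ x \in m)) => [[x [x0 xm]]|hf]; last first.
  have [r hr] := endo_socle f; exists r => e; apply: hr => n nm.
  by have [->|n0] := eqVneq n 0; [rewrite scale0r | case: hf; exists n].
have /choice[a ha] : forall k, exists r, forall e, x ^+ k *: e = 0 -> f e = r *: e.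
  move=> k; have sl := submod_line (x ^+ k : R^o).
  have [|r hr] := endo_scalar_ideal sl _ f.
    by exists (x ^+ k); [exact: mem_line | rewrite expf_eq0 negb_and x0 orbT].
  exists r => e xe; apply: hr => _ [t ->].
  by rewrite -[t *: _]/(t * _) -scalerA xe scaler0.
have [|l hl] := pow_complete R_noetherian R_local R_dim x0 xm R_complete (u := a).
  move=> k; have [|w ->] := @annihilator_sub (line (x ^+ k : R^o)) (a k.+1 - a k) (submod_line _).
    move=> e /(_ _ (mem_line _)) xe.
    rewrite scalerBl -ha -?ha ?subrr // exprS -scalerA.
    by rewrite xe scaler0.
  by exists w; rewrite mulrC.
exists l => e; have [k xe] := envelope_torsion e x0 xm.
have [w /eqP] := hl k; rewrite subr_eq => /eqP ak.
by rewrite (ha k) // ak scalerDl mulrC -scalerA xe scaler0 add0r.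
Qed.

(** Since Hom(R, E) = E, a functional on it is an endomorphism of E, hence multiplication by some r,
    which is evaluation at r. *)
Lemma eval_surj_ring : eval_surj E R^o.
Proof.
move=> xi; have hl (e : E) : linear (fun r : R^o => r *: e).
  by move=> a u v; rewrite scalerDl scalerA.
have xl : linear (fun e => xi (hom_of (hl e))).
  move=> a u v; rewrite -[RHS]hom_linear; congr (xi _); apply: hom_eq => r.
  by rewrite -[RHS]/(a *: (r *: u) + r *: v) /= scalerDr !scalerA mulrC.
have [r hr] := endo_scalar (lin xl); exists r => f.
have -> : f = hom_of (hl (f 1)).
  by apply: hom_eq => s /=; rewrite -homZ [_ *: _]mulr1.
exact: (hr (f 1)).
Qed.

(** A point outside the image would give an endomorphism of E, thus a scalar r != 0, killing the
    image; but g(z) = r g(z/r). *)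
Lemma map_to_envelope_surj (g : {linear Q -> E}) z : g z != 0 -> forall e,
  exists q, g q = e.
Proof.
move=> gz e; apply: contrapT => h.
have sA : submod (range g).
  split; first by exists 0 => //; rewrite linear0.
  by move=> a _ _ [u _ <-] [v _ <-]; exists (a *: u + v) => //; rewrite linearP.
have [|f [fA fe]] := cogenerator R_noetherian R_local E_envelope (z := e) sA.
  by move=> [q _ qe]; apply: h; exists q.
have [r hr] := endo_scalar f.
have r0 : r != 0 by apply: contraNneq fe => r0; rewrite hr r0 scale0r.
case/eqP: gz; have -> : z = r *: (r%:F^-1 * z) by rewrite frac_scaleE mulVKf ?tofrac_neq0.
by rewrite linearZ /= -hr fA //; exists (r%:F^-1 * z).
Qed.

(** A nonzero divisible part of the kernel would be all of Q, contradicting g(z) != 0. *)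
Lemma kernel_fg (g : {linear Q -> E}) z : g z != 0 ->
  exists l, (forall s, s \in l -> g s = 0) /\
    forall s, g s = 0 -> exists a : nat -> R, s = \sum_(j < size l) a j *: l`_j.
Proof.
move=> gz; pose K : set Q := [set s | g s = 0].
have sK : submod K.
  split; first exact: linear0.
  by move=> a u v gu gv; rewrite /K /= linearP gu gv scaler0 addr0.
have [b Kb hb] : exists2 b, K b & forall s, K s ->
  exists r a : R, r != 0 /\ r *: s = a *: b.
  case: (pselect (exists2 b, K b & b != 0)) => [[b Kb b0]|h].
    exists b => // s _; have [a [r [r0 e]]] := fracP (s / b); exists r, a; split=> //.
    rewrite !frac_scaleE -[s](mulfVK b0) e !mulrA [_ * a%:F]mulrC mulfK ?tofrac_neq0 //.
  exists 0; first exact: submod0 sK.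
  move=> s Ks; have [->|s0] := eqVneq s 0; last by case: h; exists s.
  by exists 1, 1; rewrite oner_neq0.
have tor s : K s -> exists2 r, r != 0 & mspan (fun _ : 'I_1 => b) (r *: s).
  by move=> /hb[r [a [r0 e]]]; exists r => //; exists (fun=> a); rewrite big_ord1.
have [l [D [lK sD DK Ddiv Kl]]] := fg_plus_divisible R_noetherian R_local R_dim
  R_complete (@frac_tf R) sK (fun=> Kb) tor.
exists l; split=> // s /Kl[a Da]; exists a; apply/eqP; rewrite -subr_eq0;
  apply: contraNT gz.
set d := s - _ in Da * => d0; apply/eqP/DK.
have [c [e [e0 ze]]] := fracP (z / d); have [d' Dd' dd'] := Ddiv _ _ e0 Da.
have -> : z = c *: d'.
  rewrite -[z](mulfVK d0) ze dd' !frac_scaleE mulrA mulfVK ?tofrac_neq0 //.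
exact: submodZ.
Qed.

(** Choose q_k with g(q_k) = f(x^-k). Then x q_(k+1) - q_k lies in the finitely generated kernel of
    g, so the x^k q_k converge, and their limit is the multiplier. *)
Lemma map_to_envelope_lift (f g : {linear Q -> E}) z : g z != 0 ->
  (exists x, x != 0 /\ x \in m) -> exists q, forall y, f y = g (q * y).
Proof.
move=> gz [x [x0 xm]]; have xF k : (x ^+ k)%:F != 0 :> Q.
  by rewrite tofrac_neq0 // expf_eq0 negb_and x0 orbT.
have [l [lK hl]] := kernel_fg gz.
have /choice[q hq] : forall k, exists q, g q = f (x ^+ k)%:F^-1.
  by move=> k; exact: (map_to_envelope_surj gz).
have /choice[a ha] : forall k, exists a : nat -> R,
    x *: q k.+1 - q k = \sum_(j < size l) a j *: l`_j.
  move=> k; apply: hl; rewrite linearB linearZ /= !hq -linearZ /= exprS tofracM.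
  by rewrite frac_scaleE invfM mulVKf ?subrr ?tofrac_neq0.
pose u k j := \sum_(s < k) x ^+ s * a s j.
have hu k : x ^+ k *: q k = q 0%N + \sum_(j < size l) u k j *: l`_j.
  elim: k => [|k ih].
    by rewrite expr0 scale1r big1 ?addr0 // => j _; rewrite /u big_ord0 scale0r.
  have -> : x ^+ k.+1 *: q k.+1 = x ^+ k *: q k + x ^+ k *: (x *: q k.+1 - q k).
    by rewrite scalerBr scalerA -exprSr addrC subrK.
  rewrite ih ha -addrA; congr (_ + _); rewrite scaler_sumr -big_split.
  by apply: eq_bigr => j _ /=; rewrite scalerA -scalerDl /u big_ord_recr.
have /choice[L hL] : forall j, exists l, forall k, exists w, u k j - l = x ^+ k * w.
  move=> j; apply: (pow_complete R_noetherian R_local R_dim x0 xm R_complete (u :=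
    fun k => u k j)) => k.
  by exists (a k j); rewrite /u big_ord_recr /= addrAC subrr add0r.
pose p := q 0%N + \sum_(j < size l) L j *: l`_j.
have hp k : g (p * (x ^+ k)%:F^-1) = f (x ^+ k)%:F^-1.
  have /choice[w hw] : forall j, exists w, u k j - L j = x ^+ k * w by move=> j.
  have -> : p * (x ^+ k)%:F^-1 = q k - \sum_(j < size l) w j *: l`_j.
    apply: (mulfI (xF k)); rewrite mulrCA mulfV // mulr1 -frac_scaleE.
    rewrite scalerBr hu /p -addrA; congr (_ + _).
    rewrite scaler_sumr -sumrB; apply: eq_bigr => j _.
    by rewrite scalerA -hw scalerBl opprB addrC subrK.
  rewrite linearB hq linear_sum big1 ?subr0 // => j _.
  by rewrite linearZ /= lK ?scaler0 // mem_nth.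
exists p => y; have [a0 [b [b0 ->]]] := fracP y.
have [k [s xs]] := dvd_pow R_noetherian R_local R_dim xm b0.
have -> : a0%:F / b%:F = (a0 * s) *: (x ^+ k)%:F^-1.
  rewrite xs frac_scaleE !tofracM invfM mulrA mulfK //.
  by have := xF k; rewrite xs tofracM mulf_eq0 negb_or => /andP[].
by rewrite linearZ /= -hp -linearZ /= !frac_scaleE mulrCA.
Qed.

(** Every map Q -> E is g0(q -) for a fixed nonzero g0. Hence q |-> xi(g0(q -)) is g0(s -) for some
    s, and xi is evaluation at s. If [m] is zero, Q is a quotient of R. *)
Lemma eval_surj_frac : eval_surj E Q.
Proof.
case: (pselect (exists x, x != 0 /\ x \in m)) => [nf|hf].
  have [|g0 [_ g1]] := cogenerator R_noetherian R_local E_envelope (z := 1 : Q)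
    (@submod_set0 _ Q).
    by move=> /eqP; rewrite oner_eq0.
  move=> xi; have gl q : linear (fun y : Q => g0 (q * y)).
    by move=> a u v; rewrite -linearP; congr (g0 _); rewrite mulrDr !frac_scaleE mulrCA.
  have xl : linear (fun q => xi (hom_of (gl q))).
    move=> a u v; rewrite -[RHS]hom_linear; congr (xi _); apply: hom_eq => y /=.
    by rewrite -[RHS]linearP; congr (g0 _); rewrite mulrDl !frac_scaleE mulrA.
  have [s hs] := map_to_envelope_lift (lin xl) g1 nf.
  exists s => f; have [q hq] := map_to_envelope_lift (hom_lin f) g1 nf.
  have -> : f = hom_of (gl q) by apply: hom_eq => y; exact: hq.
  by rewrite [LHS](hs q) /= mulrC.
have fl : linear ((fun r : R => r%:F) : R^o -> Q).
  by move=> a u v; rewrite frac_scaleE -tofracM -tofracD.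
apply: (eval_surj_quot E_injective (p := lin fl) eval_surj_ring) => q.
have [a [b [b0 ->]]] := fracP q.
have [|t tb] := @local_inv _ _ R_noetherian R_local b.
  by apply/negP => bm; apply: hf; exists b.
exists (a * t); rewrite /= tofracM; congr (_ * _).
apply: (mulIf (tofrac_neq0 b0)); rewrite mulVf ?tofrac_neq0 //.
by rewrite -tofracM tb tofrac1.
Qed.

Lemma finite_rank_reflexive (S : lmodType R) :
  torsion_free S -> finite_rank S -> matlis_reflexive E S.
Proof.
move=> S_tf S_rank; apply: eval_surj_reflexive.
have [t [M [[n [g hg]] [f [f' fK f'K]]]]] :=
  torsion_free_decomposition R_noetherian R_local R_dim R_complete S_tf S_rank.
have gl : linear (fun a : {ffun 'I_n -> R^o} => \sum_j a j *: g j).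
  move=> a u v; rewrite scaler_sumr -big_split; apply: eq_bigr => j _ /=.
  by rewrite !ffunE scalerDl scalerA.
have sM : eval_surj E M.
  apply: (eval_surj_quot E_injective (p := lin gl)).
    exact: eval_surj_ffun eval_surj_ring.
  move=> x; have [a ->] := hg x; exists [ffun j => a j].
  by apply: eq_bigr => j _; rewrite ffunE.
have f'l : linear f'.
  by move=> a u v; apply: (can_inj fK); rewrite linearP !f'K.
apply: (eval_surj_quot E_injective (p := lin f'l)) => [|s]; last by exists (f s).
by apply: eval_surj_prod => //; apply: eval_surj_ffun; exact: eval_surj_frac.
Qed.

End Matlis.

(** * Primes of height one *)

Section PrincipalIdealTheorem.
Variable R : idomainType.
Hypothesis R_noetherian : noetherian R.
Implicit Types (P p N : set R^o) (y z t : R).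

Lemma primeM P a b : prime_set P -> ~ P a -> ~ P b -> ~ P (a * b).
Proof. by move=> [_ _ pP] nPa nPb /pP[]. Qed.

Lemma primeX P a n : prime_set P -> ~ P a -> ~ P (a ^+ n).
Proof.
move=> pP nPa; elim: n => [|n ih]; first by have [] := pP.
by rewrite exprS; exact: primeM.
Qed.

Definition minimal_over y P := [/\ prime_set P, P y &
  forall p, prime_set p -> p y -> p `<=` P -> P `<=` p].

(** Zorn's lemma runs on the removed sets X, so that increasing X means decreasing primes. *)
Lemma minimal_prime y P : prime_set P -> P y ->
  exists2 P', minimal_over y P' & P' `<=` P.
Proof.
move=> pP Py; pose T (X : set R^o) := prime_set (P `\` X) /\ (P `\` X) y.
have T0 : T set0 by rewrite /T setD0.
have [F FT Ftot|X [[pX Xy] Xmax]] := Zorn_bigcup (P := T).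
  split; last by split=> // -[X FX Xy]; have [_ []] := FT X FX.
  split.
  - split; first by split=> [|[X FX X0]];
    [have [/submod0] := pP | have [[/submod0[]]] := FT X FX].
    move=> a u v [Pu Fu] [Pv Fv]; split; first by have [[_ h] _ _] := pP; apply: h.
    move=> [X FX Xw]; have [[[_ h] _ _] _] := FT X FX.
    have [] := h a u v; last by [].
      by split=> // Xu; apply: Fu; exists X.
    by split=> // Xv; apply: Fv; exists X.
  - by move=> [P1 _]; have [] := pP.
  - move=> a b [Pab Fab].
    (* The empty set stands for the prime P itself, for factors already outside P. *)
    suff key Z : (F Z \/ Z = set0) -> (Z a \/ ~ P a) -> (Z b \/ ~ P b) -> False.
      apply: contrapT => /not_orP[na nb].
      have ex c : ~ (P `\` \bigcup_(X in F) X) c ->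
        exists2 Z, F Z \/ Z = set0 & Z c \/ ~ P c.
        move=> nc; case: (pselect (P c)) => Pc; last by exists set0; right.
        case: (pselect ((\bigcup_(X in F) X) c)) => [[Z FZ Zc]|h]; last by case: nc.
        by exists Z; left.
      have [Z1 F1 h1] := ex a na; have [Z2 F2 h2] := ex b nb.
      have [sub|sub] : Z1 `<=` Z2 \/ Z2 `<=` Z1.
        case: F1 => [F1|->]; last by left.
        by case: F2 => [F2|->]; [exact: Ftot | right].
      - by apply: (key Z2) => //; case: h1 => [/sub|]; [left|right].
      - by apply: (key Z1) => //; case: h2 => [/sub|]; [left|right].
    move=> FZ ha hb.
    have [pZ _] : T Z by case: FZ => [/FT|->].
    have [_ _ /(_ a b) [|[Pa nZa]|[Pb nZb]]] := pZ.
    + by split=> // Zab; case: FZ Zab => [FZ Zab|->//]; apply: Fab; exists Z.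
    + by case: ha.
    + by case: hb.
exists (P `\` X) => [|r []//]; split=> // p pp py pX'.
apply: contrapT => h; apply: (Xmax (~` p)).
  split.
    by move=> r Xr pr; have [] := pX' r pr.
  by move=> h'; apply: h => r [Pr nXr]; apply: contrapT => /h'.
have -> // : T (~` p) = (prime_set p /\ p y).
rewrite /T setDE setCK (_ : P `&` p = p) //.
by apply/setIidr => r /pX'[].
Qed.

(** This is the descending chain condition in (R/N)_P. If N is prime, either N is not inside P and
    the localization vanishes, or N = P by minimality and the localization is a field. *)
Lemma saturated_dcc P y : minimal_over y P ->
  forall N, submod N -> N y -> forall C : nat -> set R^o,
  (forall n, submod (C n)) -> (forall n, C n.+1 `<=` C n) ->
  exists n, forall k, (n <= k)%N -> forall c, C n c ->
    exists2 t, ~ P t & msum (C k) N (t * c).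
Proof.
move=> [pP Py Pmin]; have P1 : ~ P 1 by case: pP.
apply: (prime_ind R_noetherian) => [_ C sC _|N pN Ny C sC _|N a sN ih1 ih2 Ny C sC dC].
- exists 0%N => k _ c _; exists 1 => //; exists 0, (1 * c); rewrite add0r; split=> //.
  exact: submod0 (sC k).
- have [sN _ _] := pN.
  case: (pselect (exists2 t, N t & ~ P t)) => [[t Nt nPt]|h].
    exists 0%N => k _ c _; exists t => //; apply: sub_msumr => //; exact: idealMr.
  have NP : N `<=` P by move=> t Nt; apply: contrapT => nPt; apply: h; exists t.
  have PN := Pmin _ pN Ny NP.
  case: (pselect (exists n, C n `<=` P)) => [[n CP]|h'].
    exists n => k _ c /CP/PN Nc; exists 1 => //; rewrite mul1r; exact: sub_msumr.
  exists 0%N => k _ c _.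
  have [t Ct nPt] : exists2 t, C k t & ~ P t.
    apply: contrapT => ht; apply: h'; exists k => t Ct.
    by apply: contrapT => nPt; apply: ht; exists t.
  by exists t => //; apply: sub_msuml => //; exact: idealMr.
have dC' n k : (n <= k)%N -> C k `<=` C n.
  move=> /subnKC <-; elim: (k - n)%N => [|j ihj]; first by rewrite addn0.
  by rewrite addnS; exact: subset_trans ihj.
have sl := submod_line a.
have Ny1 : msum N (line a) y by exact: sub_msuml.
have [n1 h1] := ih1 Ny1 C sC dC.
have Ny2 : colon N a y by exact: idealMr.
have sC2 n : submod (colon (msum (C n) N) a) by apply: submod_colon; exact: submod_msum.
have dC2 n : colon (msum (C n.+1) N) a `<=` colon (msum (C n) N) a.
  by move=> r [u [v [/dC Cu Nv e]]]; exists u, v.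
have [n2 h2] := ih2 Ny2 _ sC2 dC2.
exists (maxn n1 n2) => k; rewrite geq_max => /andP[k1 k2] c Cc.
have [t nPt [c' [_ [Cc' [u [_ [Nu [r ->] ->]]] e]]]] :=
  h1 k k1 c (dC' _ _ (leq_maxl _ _) _ Cc).
have Cr : colon (msum (C n2) N) a r.
  exists (t * c - c'), (- u); split;
    last by rewrite e [c' + _]addrC addrK [u + _]addrC addrK.
    apply: (@submodB _ R^o) => //; last exact: dC' k2 _ Cc'.
    by apply: idealM => //; exact: dC' (leq_maxr _ _) _ Cc.
  exact: (@submodN _ R^o).
have [t' nPt' [r1 [r2 [Cr1 Nr2 e']]]] := h2 k k2 r Cr.
exists (t' * t); first exact: primeM.
have sCN : submod (msum (C k) N) by exact: submod_msum.
have CCN : C k `<=` msum (C k) N by exact: sub_msuml.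
have NCN : N `<=` msum (C k) N by exact: sub_msumr.
rewrite -mulrA e !mulrDr; apply: (@submodD _ R^o) => //.
  by apply: CCN; exact: idealM.
apply: (@submodD _ R^o) => //; first by apply: NCN; exact: idealM.
rewrite mulrA -[t' * r]/(t' * r) e' mulrDl; apply: (@submodD _ R^o) => //.
exact: NCN.
Qed.

End PrincipalIdealTheorem.

Section HeightOne.
Variable R : idomainType.
Hypothesis R_noetherian : noetherian R.
Implicit Types (P p : set R^o) (y z t : R).

(** Nakayama at P, removing one generator s at a time: from t s = b + y a and t' a = u + r s, the
    element t' t - y r outside P carries s into the span of the rest. *)
Lemma local_nakayama P y (A B : set R^o) (l : seq R^o) :
  prime_set P -> P y -> submod A -> submod B -> B `<=` A ->
  (forall c, A c -> exists t b a, [/\ ~ P t, B b, A a & t * c = b + y * a]) ->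
  (forall s, s \in l -> A s) ->
  (forall c, A c -> exists2 t, ~ P t & adj B l (t * c)) ->
  forall c, A c -> exists2 t, ~ P t & B (t * c).
Proof.
move=> pP Py sA sB BA hA; elim: l => [|s l ih] //= lA hl; apply: ih.
  by move=> r rl; apply: lA; rewrite inE rl orbT.
have sBl : submod (adj B l) by exact: submod_adj.
have BBl : B `<=` adj B l by exact: sub_adj.
have As : A s by apply: lA; exact: mem_head.
have [t nPt ts] : exists2 t, ~ P t & adj B l (t * s).
  have [t [b [a [nPt Bb Aa e]]]] := hA s As.
  have [t' nPt' [u [_ [Bu [r ->] e']]]] := hl a Aa.
  exists (t' * t - y * r).
    move=> h; apply: (primeM pP nPt' nPt); have [sP _ _] := pP.
    by rewrite -[t' * t](subrK (y * r)); apply: (@submodD _ R^o) => //; exact: idealMr.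
  have -> : (t' * t - y * r) * s = t' * b + y * u.
    rewrite mulrBl -mulrA e mulrDr mulrCA e' mulrDr -[r *: s]/(r * s).
    by rewrite !addrA -[y * r * s]mulrA addrK.
  by apply: (@submodD _ R^o) => //; apply: idealM => //; exact: BBl.
move=> c Ac; have [t' nPt' [u [_ [Bu [r ->] e]]]] := hl c Ac.
exists (t * t'); first exact: primeM.
rewrite -mulrA e mulrDr; apply: (@submodD _ R^o) => //; first exact: idealM.
by rewrite -[r *: s]/(r * s) mulrCA; exact: idealM.
Qed.

(* The ideals of the elements r with s r in z^n R for some s outside p replace *)
(* the symbolic powers of p in Krull's argument.                               *)
Lemma krull_height_one P y : minimal_over y P ->
  forall p z, prime_set p -> p `<=` P -> p z -> z != 0 -> P `<=` p.
Proof.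
move=> minP p z pp pP pz z0; have [PP Py Pmin] := minP.
apply: contrapT => nPp; have npy : ~ p y by move=> py; apply: nPp; exact: Pmin.
pose C n : set R^o := [set r | exists s b : R, ~ p s /\ s * r = z ^+ n * b].
have sC n : submod (C n).
  split; first by exists 1, 0; rewrite !mulr0; split=> //; have [] := pp.
  move=> a u v [s [b [nps e]]] [s' [b' [nps' e']]].
  exists (s * s'), (a * s' * b + s * b'); split; first exact: primeM.
  transitivity (a * s' * (s * u) + s * (s' * v)).
    by rewrite -[a *: u]/(a * u); ring.
  by rewrite e e'; ring.
have dC n : C n.+1 `<=` C n.
  by move=> r [s [b [nps e]]]; exists s, (z * b); rewrite e exprSr mulrA.
have [n hn] := saturated_dcc R_noetherian minP (submod_line (y : R^o)) (mem_line _) sC dC.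
have {}hn := hn n.+1 (leqnSn n).
have [k [g gC]] := ideal_fg R_noetherian (sC n).
(* Here a y lies in [C n], and y is invertible at p, so a itself lies in [C n]. *)
have nak c : C n c -> exists t b a, [/\ ~ P t, C n.+1 b, C n a & t * c = b + y * a].
  move=> Cc; have [t nPt [b [_ [Cb [a ->] e]]]] := hn c Cc.
  exists t, b, a; split=> //; last by rewrite e [_ *: _]mulrC.
  have [s [d [nps sd]]] : C n (a * y).
    rewrite (_ : a * y = t * c - b); last by rewrite e addrC addKr.
    by apply: (@submodB _ R^o) => //; [exact: idealM | exact: dC].
  exists (s * y), d; split; first exact: primeM.
  by rewrite -sd; ring.
have lC (s : R^o) : s \in map g (enum 'I_k) -> C n s.
  by move=> /mapP[j _ ->]; rewrite gC; exact: mem_span.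
have spanC c : C n c -> exists2 t, ~ P t & adj (C n.+1) (map g (enum 'I_k)) (t * c).
  move=> Cc; exists 1; [by have [] := PP | rewrite mul1r].
  move: Cc; rewrite {1}gC; apply: span_sub; first exact: submod_adj.
  by move=> j; apply: mem_adj => //; apply: map_f; rewrite mem_enum.
have Cz : C n (z ^+ n) by exists 1, 1; rewrite mul1r mulr1; split=> //; have [] := pp.
have [t nPt [s [b [nps e]]]] := local_nakayama PP Py (sC n) (sC n.+1) (@dC n) nak lC spanC Cz.
(* Cancelling z^n from s t z^n = z^(n+1) b puts s t in p, although neither factor is. *)
apply: (primeM pp nps (fun pt => nPt (pP _ pt))).
suff -> : s * t = z * b by have [sp _ _] := pp; exact: idealMr.
have zn : z ^+ n != 0 by rewrite expf_eq0 (negPf z0) andbF.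
apply: (mulIf zn); transitivity (s * (t * z ^+ n)); first by ring.
by rewrite e exprS; ring.
Qed.

Definition height_one P :=
  prime_set P /\ forall p z, prime_set p -> p `<=` P -> p z -> z != 0 -> P `<=` p.

Lemma height_one_exists P y : prime_set P -> P y -> y != 0 ->
  exists P', [/\ height_one P', P' y & P' `<=` P].
Proof.
move=> pP Py y0; have [P' minP P'P] := minimal_prime pP Py.
exists P'; split=> //; last by case: minP.
by split; [case: minP | exact: krull_height_one minP].
Qed.

Definition loc P : set {fraction R} :=
  [set z | exists a s : R, ~ P s /\ z = a%:F / s%:F].

Section Localization.
Variable P : set R^o.
Hypothesis pP : prime_set P.

Lemma prime_compl_neq0 (s : R) : ~ P s -> s%:F != 0 :> {fraction R}.
Proof.
move=> nPs; rewrite tofrac_eq0; apply/eqP => s0; apply: nPs.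
by rewrite s0; have [/submod0] := pP.
Qed.

Lemma loc_tofrac (a : R) : loc P a%:F.
Proof. by exists a, 1; rewrite tofrac1 divr1; split=> //; have [] := pP. Qed.

Lemma loc_div (z : {fraction R}) (s : R) : loc P z -> ~ P s -> loc P (z / s%:F).
Proof.
move=> [a [t [nPt ->]]] nPs; exists a, (t * s); split; first exact: primeM.
by rewrite tofracM invfM mulrA.
Qed.

Lemma submod_loc : submod (loc P).
Proof.
split; first by rewrite -tofrac0; exact: loc_tofrac.
move=> a _ _ [b [s [nPs ->]]] [c [t [nPt ->]]].
exists (a * b * t + c * s), (s * t); split; first exact: primeM.
have s0 := prime_compl_neq0 nPs; have t0 := prime_compl_neq0 nPt.
by rewrite frac_scaleE mulrA addf_div // !tofracM tofracD !tofracM.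
Qed.

Lemma loc_inv (p : R) : P p -> p != 0 -> ~ loc P p%:F^-1.
Proof.
move=> Pp p0 [a [s [nPs e]]]; apply: (nPs).
suff -> : s = a * p by have [sP _ _] := pP; exact: idealM.
apply: (@tofrac_inj R); rewrite tofracM.
have s0 := prime_compl_neq0 nPs; have p0' := tofrac_neq0 p0.
by rewrite -[a%:F](mulfVK s0) -e mulrAC mulVf // mul1r.
Qed.

End Localization.

(** That is, inverting y in R_P gives Q. Otherwise a prime containing the denominator r avoids y and
    the complement of P; it is a nonzero prime inside P, so it equals P and contains y. *)
Lemma loc_pow P (y : R) : height_one P -> P y -> forall z : {fraction R},
  exists N, loc P (y%:F ^+ N * z).
Proof.
move=> [pP hP] Py z; have [a [r [r0 ->]]] := fracP z.
suff [N [s [b [nPs e]]]] : exists N (s b : R), ~ P s /\ s * y ^+ N = b * r.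
  exists N, (a * b), s; split=> //.
  have s0 := prime_compl_neq0 pP nPs; have r0' := tofrac_neq0 r0.
  apply: (mulIf s0); rewrite mulfVK // mulrAC -tofracXn -tofracM [y ^+ N * s]mulrC e.
  by rewrite !tofracM mulrCA mulfK.
apply: contrapT => h.
pose M := [set t : R | exists N (s : R), ~ P s /\ t = s * y ^+ N].
have nP1 : ~ P 1 by case: pP.
have [||t [N [s [nPs ->]]] [b e]|P' [pP' rP' MP']] :=
    @prime_avoiding _ R_noetherian (line (r : R^o)) M (submod_line _).
- by exists 0%N, 1; rewrite mulr1.
- move=> _ _ [N [s [nPs ->]]] [N' [s' [nPs' ->]]]; exists (N + N')%N, (s * s').
  by split; [exact: primeM | rewrite exprD mulrACA].
- by apply: h; exists N, s, b.
have P'P : P' `<=` P.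
  by move=> t P't; apply: contrapT => nPt; apply: (MP' t) => //; exists 0%N, t;
    rewrite mulr1.
apply: (MP' y); first by exists 1%N, 1; rewrite mul1r.
by apply: (hP P' r) => //; apply: rP'; exact: mem_line.
Qed.

(* Weak approximation: 1 = x^M/d + y^N/d with d = x^M + y^N a unit at both    *)
(* primes, and each summand is small at one of them.                          *)
Lemma loc_sum P1 P2 (x y : R) : height_one P1 -> height_one P2 ->
  P1 y -> ~ P2 y -> P2 x -> ~ P1 x ->
  forall q z : {fraction R}, q != 0 ->
    exists u v, [/\ loc P1 u, loc P2 v & z = u + q * v].
Proof.
move=> h1 h2 P1y nP2y P2x nP1x q z q0.
have [pP1 _] := h1; have [pP2 _] := h2.
have [N hN] := loc_pow h1 P1y z; have [M hM] := loc_pow h2 P2x (z / q).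
have [[sP1 _ _] [sP2 _ _]] := (pP1, pP2).
(* The exponents are raised by one to be positive: then y^(N+1) lies in P1 and x^(M+1) in P2. *)
pose d : R := x ^+ M.+1 + y ^+ N.+1.
have nd1 : ~ P1 d.
  move=> P1d; apply: (primeX (n := M.+1) pP1 nP1x).
  rewrite (_ : x ^+ _ = d - y ^+ N.+1); last by rewrite /d addrK.
  by apply: (@submodB _ R^o) => //; rewrite exprS; exact: idealMr.
have nd2 : ~ P2 d.
  move=> P2d; apply: (primeX (n := N.+1) pP2 nP2y).
  rewrite (_ : y ^+ _ = d - x ^+ M.+1); last by rewrite /d addrC addKr.
  by apply: (@submodB _ R^o) => //; rewrite exprS; exact: idealMr.
exists (y%:F ^+ N.+1 * z / d%:F), (x%:F ^+ M.+1 * (z / q) / d%:F); split.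
- apply: loc_div => //; rewrite exprS -mulrA;
  apply: (submodZ (V := {fraction R})) => //.
  exact: submod_loc.
- apply: loc_div => //; rewrite exprS -mulrA;
  apply: (submodZ (V := {fraction R})) => //.
  exact: submod_loc.
have d0 := prime_compl_neq0 pP1 nd1.
have dE : d%:F = x%:F ^+ M.+1 + y%:F ^+ N.+1 by rewrite tofracD !tofracXn.
apply: (mulIf d0).
rewrite mulrDl mulfVK // -[q * _ * _]mulrA mulfVK // [q * (_ * _)]mulrCA.
by rewrite [q * _]mulrC mulfVK // -mulrDl dE addrC mulrC.
Qed.

End HeightOne.

(** * Conclusion *)

Lemma subm_torsion_free (R : idomainType) (V : lmodType R) (A : set V) (sA : submod A) :
  torsion_free V -> torsion_free (subm sA).
Proof.
move=> V_tf a s e; have /V_tf[|s0] : a *: val s = 0 by exact: (congr1 val e).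
  by left.
by right; apply: val_inj.
Qed.

(** Extend a |-> a v along multiplication by r on R; the extension sends 1 to w. *)
Lemma injective_divisible (R : idomainType) (S : lmodType R) : injective_module S ->
  forall (r : R) (v : S), r != 0 -> exists w, v = r *: w.
Proof.
move=> injS r v r0.
have l1 : linear (fun a : R^o => a * r : R^o).
  by move=> a u w; rewrite mulrDl scalerAl.
have l2 : linear (fun a : R^o => a *: v) by move=> a u w; rewrite scalerDl scalerA.
have [a b /(mulIf r0)//|g hg] := injS _ _ (lin l1) (lin l2).
exists (g 1); have := hg 1; rewrite /= mul1r scale1r => <-.
by rewrite -linearZ /= [_ *: _]mulr1.
Qed.

Section DimOneInjective.
Variables (R : idomainType) (m : idealr R).
Hypotheses (R_noetherian : noetherian R) (R_local : local_with m).
Hypothesis R_dim : krull_dim_le R 1.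

Lemma max_divisible (S : lmodType R) (r : R) :
  ideal_smul m [set: S] = [set: S] -> r != 0 -> forall v : S, exists w, v = r *: w.
Proof.
move=> mS r0.
(* The claim is N S = S for every nonzero ideal N, phrased through the submodules B containing N S;
   it is used with B = r S. *)
suff H : forall N : set R^o, submod N -> (exists2 r, N r & r != 0) ->
    forall B : set S, submod B -> (forall r s, N r -> B (r *: s)) -> forall s, B s.
  move=> v; suff [w _ <-] : smul r setT v by exists w.
  apply: (H _ (submod_line (r : R^o))); first by exists r => //; exact: mem_line.
    exact: submod_smul.
  by move=> _ s [t ->]; exists (t *: s) => //; rewrite scalerA mulrC.
apply: (prime_ind R_noetherian)
  => [_ B _ h s|P pP nzP B sB h s|N a sN ih1 ih2 nzN B sB h].
- by rewrite -[s]scale1r; exact: h.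
- have [n [c [w [cw ->]]]] : ideal_smul m [set: S] s by rewrite mS.
  apply: submod_sum => // j _; apply: h.
  by apply: (nonzero_prime R_noetherian R_local R_dim pP nzP); have [] := cw j.
- have aB s : B (a *: s).
    apply: (ih2 _ [set s | B (a *: s)]).
    + by apply: nz_sub nzN => x Nx; exact: idealMr.
    + by split=> [|b u v Bu Bv] /=; [rewrite scaler0; exact: submod0 sB |
        rewrite scalerDr scalerA mulrC -scalerA; case: sB => _; apply].
    + by move=> x t Nx /=; rewrite scalerA mulrC; exact: h.
  apply: ih1 => //; first by apply: nz_sub nzN; apply: sub_msuml; exact: submod_line.
  move=> _ s [n [_ [Nn [t ->] ->]]]; rewrite scalerDl -scalerA.
  by apply: submodD => //; [exact: h | exact: submodZ].
Qed.

Lemma max_divisible_injective (S : lmodType R) : ~ GRing.field_axiom R ->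
  torsion_free S ->
  (ideal_smul m [set: S] = [set: S] <-> injective_module S).
Proof.
move=> nf S_tf; split=> [mS|injS].
  by apply: divisible_injective => // r v r0; exact: max_divisible.
have [x [x0 xm]] : exists x, x != 0 /\ x \in m.
  apply: contrapT => h; apply: nf => x x0;
    have [|s sx] := @local_inv _ _ R_noetherian R_local x.
    by apply/negP => xm; apply: h; exists x.
  by apply/unitrPr; exists s; rewrite mulrC.
apply/seteqP; split=> // v _; have [w ->] := injective_divisible injS v x0.
by exists 1%N, (fun=> x), (fun=> w); rewrite big_ord1.
Qed.

End DimOneInjective.

(** * The localization R_P as a counterexample *)

Section Localization.
Variables (R : idomainType) (m : idealr R).
Variables (P : set R^o) (pP : prime_set P) (x y : R).
Hypotheses (xm : x \in m) (nPx : ~ P x) (Py : P y) (y0 : y != 0).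
Local Notation Q := {fraction R}.
Local Notation RP := (subm (submod_loc pP)).

Lemma loc_torsion_free : torsion_free RP.
Proof. exact: subm_torsion_free (@frac_tf R). Qed.

Let vl : linear (val : RP -> Q). Proof. by []. Qed.

Lemma loc_finite_rank : finite_rank RP.
Proof.
apply: (finite_rank1 (j := lin vl) (s0 := insubm (loc_tofrac pP 1))).
  exact: val_inj.
apply/eqP => /(congr1 val) /= /eqP; apply/negP.
by rewrite tofrac1; exact: oner_neq0.
Qed.

Lemma loc_max_smul : ideal_smul m [set: RP] = [set: RP].
Proof.
apply/seteqP; split=> // v _; exists 1%N, (fun=> x), (fun=> insubm (loc_div pP (submP v) nPx)).
split=> //; rewrite big_ord1; apply: subm_eq.
rewrite linearZ /= frac_scaleE mulrC mulfVK //; exact: (prime_compl_neq0 pP).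
Qed.

Lemma loc_not_injective : ~ injective_module RP.
Proof.
move=> /injective_divisible /(_ y (insubm (loc_tofrac pP 1)) y0)[w /(congr1 val) /= e].
apply: (loc_inv pP Py y0); suff -> : y%:F^-1 = val w by exact: submP.
by apply: (mulfI (tofrac_neq0 y0)); rewrite mulfV ?tofrac_neq0.
Qed.

Hypothesis R_complete : adically_complete m.

(** The constant sequence s would converge to both s and 0. *)
Lemma powers_separated s : (forall k, exists w, s = x ^+ k * w) -> s = 0.
Proof.
move=> hs; have [n|l [_ lu]] := R_complete (u := fun=> s).
  by exists 0%N => i j _ _; rewrite subrr; have := @ideal_exp_pow _ m x n 0 xm;
    rewrite mulr0.
rewrite -(lu s); last first.
  by move=> n; exists 0%N => i _; rewrite subrr; have := @ideal_exp_pow _ m x n 0 xm;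
    rewrite mulr0.
apply: lu => n; exists 0%N => i _; rewrite subr0; have [w ->] := hs n.
exact: ideal_exp_pow.
Qed.

(** If t = 0, finitely many generators of R_P have a common denominator outside P; as R_P contains
    all x^-k, every x^k divides it, so it is 0. If t > 0, a copy of Q inside R_P would make y
    invertible there. *)
Lemma loc_not_decomposable : ~ exists t (M : lmodType R),
  fin_gen M /\ lmod_iso RP ({ffun 'I_t -> Q} * M)%type.
Proof.
move=> [t [M [[n [g hg]] [f [f' fK f'K]]]]].
have f'l : linear f' by move=> a u v; apply: (can_inj fK); rewrite linearP !f'K.
pose h := lin f'l; case: t f f' fK f'K f'l @h => [|t] f f' fK f'K f'l h.
  pose G (j : 'I_n) : Q := val (h (0, g j)).
  have /choice[a /choice[s hs]] : forall j, exists a s : R, ~ P s /\ G j = a%:F / s%:F.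
    by move=> j; have := submP (h (0, g j)).
  have nPs : ~ P (\prod_j s j).
    by elim/big_ind: _ => [|u v|j _]; [have [] := pP | exact: primeM | have [] := hs j].
  have s0 : \prod_j s j = 0.
    apply: powers_separated => k.
    have lk : loc P (x ^+ k)%:F^-1.
      rewrite -div1r -tofrac1; apply: loc_div => //; last exact: primeX.
      exact: loc_tofrac.
    pose v0 : RP := insubm lk; have [c hc] := hg (f v0).2.
    have Hl : linear (fun z => h (0, z)).
      by move=> b u v; rewrite -linearP pair_linear scaler0 addr0.
    have e : (x ^+ k)%:F^-1 = \sum_j c j *: G j.
      have f0 : (f v0).1 = 0 by apply/ffunP => -[].
      rewrite -[LHS]/(val v0) -(fK v0) [f v0]surjective_pairing hc f0.
      rewrite -[f' _]/(lin Hl _) linear_sum (linear_sum (lin vl)).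
      by apply: eq_bigr => j _; rewrite !linearZ.
    exists (\sum_j c j * ((\prod_(l | l != j) s l) * a j)).
    apply: (@tofrac_inj R); rewrite tofracM.
    have xk0 : (x ^+ k)%:F != 0 :> Q by apply: (prime_compl_neq0 pP); exact: primeX.
    apply: (mulIf (invr_neq0 xk0)); rewrite {1}e mulr_sumr mulrAC mulfV // mul1r.
    rewrite rmorph_sum; apply: eq_bigr => j _ /=; have [nPsj ->] := hs j.
    rewrite (bigD1 j) //= !tofracM frac_scaleE mulrCA; congr (_ * _).
    by rewrite [(s j)%:F * _]mulrC -mulrA [(s j)%:F * _]mulrC mulfVK ?(prime_compl_neq0 pP).
  by apply: nPs; rewrite s0; have [/submod0] := pP.
pose F q := h ([ffun j => if j == ord0 then q else 0], 0).
have FZ a q : F (a *: q) = a *: F q.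
  rewrite /F -linearZ; congr (h _); congr pair; last by rewrite scaler0.
  by apply/ffunP => j; rewrite !ffunE; case: eqP; rewrite ?scaler0.
have F1 : val (F 1) != 0.
  apply/eqP => e; have : F 1 = 0 by exact: val_inj.
  rewrite /F -(linear0 h) => /(can_inj f'K) e1.
  have := congr1 (fun z : {ffun 'I_t.+1 -> Q} * M => z.1 ord0) e1.
  by rewrite !ffunE eqxx => /eqP; rewrite oner_eq0.
have [a [s [nPs e]]] := submP (F 1).
have a0 : a != 0.
  by apply: contraNneq F1 => a0; rewrite e a0 tofrac0 mul0r.
have ay0 : a * y != 0 by exact: mulf_neq0.
(* With F(1) = a/s this gives a y w = a/s, so that s w = 1/y. *)
pose w := val (F (a * y)%:F^-1).
have e' : val (F 1) = (a * y)%:F * w.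
  by rewrite -[RHS]/(val ((a * y) *: F _)) -FZ frac_scaleE mulfV ?tofrac_neq0.
have s0 := prime_compl_neq0 pP nPs.
apply: (loc_inv pP Py y0); suff -> : y%:F^-1 = s *: w.
  by apply: submodZ; [exact: submod_loc | exact: submP].
apply: (mulfI (tofrac_neq0 y0)); apply: (mulfI (tofrac_neq0 a0)).
rewrite mulfV ?tofrac_neq0 // mulr1 frac_scaleE !mulrA -tofracM.
by rewrite mulrAC -e' e mulfVK.
Qed.

End Localization.

Section NotReflexive.
Variables (R : idomainType) (m : idealr R).
Hypotheses (R_noetherian : noetherian R) (R_local : local_with m).
Variables (E : lmodType R) (i : {linear {ideal_quot m} -> E}).
Hypothesis E_envelope : is_injective_envelope i.
Local Notation Q := {fraction R}.

(** By independence, (a, b) |-> f(a -) + g(b -) embeds Q^2 in Hom(Q, E). The functional (a, b) |->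
    g(b) extends to Hom(Q, E); were it evaluation at s, f(a s) = 0 for all a would force s = 0, and
    then g = 0. *)
Lemma frac_not_reflexive : ~ krull_dim_le R 1 -> ~ matlis_reflexive E Q.
Proof.
move=> /(dim_gt1P R_noetherian R_local)[P [y [x [pP Py y0 xm nPx]]]] [inv _ invK].
have [P1 [h1 P1y P1P]] := height_one_exists R_noetherian pP Py y0.
have nP1x : ~ P1 x by move=> /P1P.
have x0 : x != 0 by apply/eqP => x0; apply: nPx; rewrite x0; have [/submod0] := pP.
have [P2 [h2 P2x _]] := height_one_exists R_noetherian (max_prime R_noetherian R_local) xm x0.
have [pP1 _] := h1; have [pP2 hP2] := h2.
have [z P1z nP2z] : exists2 z : R, P1 z & ~ P2 z.
  apply: contrapT => h; have P12 : P1 `<=` P2.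
    by move=> z P1z; apply: contrapT => nP2z; apply: h; exists z.
  exact/nP1x/(hP2 P1 y pP1 P12 P1y y0).
have z0 : z != 0 by apply/eqP => z0; apply: nP2z; rewrite z0; have [/submod0] := pP2.
have approx := loc_sum R_noetherian h1 h2 P1z nP2z P2x nP1x.
have [injE _ _] := E_envelope.
have [f [f1 fz]] := cogenerator R_noetherian R_local E_envelope (submod_loc pP1)
  (loc_inv pP1 P1z z0).
have [g [g2 gx]] := cogenerator R_noetherian R_local E_envelope (submod_loc pP2)
  (loc_inv pP2 P2x x0).
have f_faithful a : (forall w, f (a * w) = 0) -> a = 0.
  move=> fa; apply: contraNeq fz => a0; apply/eqP.
  by rewrite -[_^-1](mulVKf a0).
have g_faithful a : (forall w, g (a * w) = 0) -> a = 0.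
  move=> ga; apply: contraNeq gx => a0; apply/eqP.
  by rewrite -[_^-1](mulVKf a0).
have ZAr (a : R) (q w : Q) : q * (a *: w) = a *: (q * w) by rewrite !frac_scaleE mulrCA.
have ZAl (a : R) (q w : Q) : (a *: q) * w = a *: (q * w) by rewrite !frac_scaleE mulrA.
have kl (p : Q * Q) : linear (fun w : Q => f (p.1 * w) + g (p.2 * w)).
  by move=> a u v; rewrite !mulrDr !ZAr !linearP scalerDr addrACA.
have jl : linear (fun p => hom_of (kl p)).
  move=> a [u1 u2] [v1 v2]; apply: hom_eq => w; rewrite pair_linear /=.
  rewrite !mulrDl !ZAl !linearP addrACA -scalerDr.
  by [].
have j_faithful p : (forall w, f (p.1 * w) + g (p.2 * w) = 0) -> p = 0.
  case: p => a b /= h; have [a0|a0] := eqVneq a 0.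
    rewrite a0 (g_faithful b) // => w; have := h w.
    by rewrite a0 mul0r linear0 add0r.
  have [b0|b0] := eqVneq b 0.
    rewrite b0 (f_faithful a) // => w; have := h w.
    by rewrite b0 mul0r linear0 addr0.
  (* Writing 1/z = u + (a/b) v, f kills u and the relation at v/b gives f((a/b) v) = - g(v) = 0,
     contrary to f(1/z) != 0. *)
  case/eqP: fz; have [u [v [P1u P2v ->]]] :=
    approx (a / b) z%:F^-1 (mulf_neq0 a0 (invr_neq0 b0)).
  rewrite linearD f1 // add0r.
  by have := h (b^-1 * v); rewrite mulVKf // (g2 v) // addr0 mulrA.
have gl : linear (fun p : Q * Q => g p.2) by move=> a u v; rewrite -linearP.
have [|Xi hXi] := injE _ _ (lin jl) (lin gl).
  move=> p q e; apply/eqP; rewrite -subr_eq0; apply/eqP/j_faithful => w.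
  have : lin jl (p - q) = 0 by rewrite linearB; apply/eqP; rewrite subr_eq0; apply/eqP.
  by move/(congr1 (fun k : hom Q E => k w)).
have [s hs] : exists s, forall k : hom Q E, Xi k = k s.
  exists (inv (hom_of (linearP Xi))) => k.
  exact: (esym (congr1 (fun xi : hom (hom Q E) E => xi k) (invK (hom_of (linearP Xi))))).
have E' a b : f (a * s) + g (b * s) = g b by have := hXi (a, b); rewrite hs.
have s0 : s = 0.
  by apply: f_faithful => w; have := E' w 0; rewrite mul0r linear0 addr0 mulrC.
case/eqP: gx; rewrite -(E' 0) s0 !mulr0 !linear0 addr0.
by [].
Qed.

End NotReflexive.

(* Fields are excluded for the last assertion: over a field, m = 0, so that    *)
(* S = R is injective although m S <> S, while dim R = 0.                      *)
Theorem corollary1p4 (R : idomainType) (m : idealr R)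
    (R_noetherian : noetherian R)
    (R_local : local_with m)
    (R_complete : adically_complete m)
    (E : lmodType R) (i : {linear {ideal_quot m} -> E})
    (E_envelope : is_injective_envelope i) :
  [<-> forall S : lmodType R, torsion_free S -> finite_rank S ->
         exists t (M : lmodType R), fin_gen M /\
           lmod_iso S ({ffun 'I_t -> {fraction R}} * M)%type;
       krull_dim_le R 1;
       forall S : lmodType R, torsion_free S -> finite_rank S ->
         matlis_reflexive E S] /\
  (~ GRing.field_axiom R ->
     (krull_dim_le R 1 <->
      forall S : lmodType R, torsion_free S -> finite_rank S ->
        (ideal_smul m [set: S]%classic = [set: S]%classic <->
         injective_module S))).
Proof.
have frac_rank : finite_rank {fraction R}.
  have idl : linear (fun q : {fraction R} => q) by [].
  by apply: (finite_rank1 (j := lin idl) (s0 := 1 : {fraction R})) => //;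
    exact: oner_neq0.
have dim1_reflexive : krull_dim_le R 1 -> forall S : lmodType R,
    torsion_free S -> finite_rank S -> matlis_reflexive E S.
  by move=> hdim S S_tf; exact: (finite_rank_reflexive R_noetherian R_local E_envelope).
split; [tfae=> [h|//|h] | move=> nf; split=> [hdim|h]].
- apply: contrapT => /(dim_gt1P R_noetherian R_local)[P [y [x [pP Py y0 xm nPx]]]].
  apply: (loc_not_decomposable (pP := pP) xm nPx Py y0 R_complete).
  by apply: h; [exact: loc_torsion_free | exact: loc_finite_rank].
(* The implication from (iii) to (i) passes through the dimension, using reflexivity of Q alone. *)
- have hdim : krull_dim_le R 1.
    apply: contrapT => /(frac_not_reflexive R_noetherian R_local E_envelope); apply.
    exact: h (@frac_tf R) frac_rank.
  by move=> S S_tf; exact: (torsion_free_decomposition R_noetherian R_local hdim).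
- by move=> S S_tf _; exact: (max_divisible_injective R_noetherian R_local).
- apply: contrapT => /(dim_gt1P R_noetherian R_local)[P [y [x [pP Py y0 xm nPx]]]].
  apply: (loc_not_injective (pP := pP) Py y0).
  have [+ _] := h _ (@loc_torsion_free _ _ pP) (@loc_finite_rank _ _ pP).
  by apply; exact: (loc_max_smul pP xm nPx).
Qed.
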